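(* Let $H\in C^2(\mathbb{R}^d)$ be uniformly convex, let $F(p):=\sqrt{D^2H(p)}$, and assume that $d=1$ or, when $d>1$, that $H$ is quadratic. Let $\zeta\in C_0([0,\infty);\mathbb{R})$ and let $u\in\mathrm{BUC}(\mathbb{R}^d\times[0,\infty))$ be a pathwise viscosity solution of $du=H(Du)\cdot d\zeta$ in $\mathbb{R}^d\times(0,\infty)$. Let $M(t):=\max_{0\le s\le t}\zeta(s)$ and $m(t):=\min_{0\le s\le t}\zeta(s)$. Then, for all $t>0$, in the viscosity sense in $\mathbb{R}^d$, $$-\frac{1}{M(t)-\zeta(t)}\,I\ \le\ -F(Du(\cdot,t))\,D^2u(\cdot,t)\,F(Du(\cdot,t))\ \le\ \frac{1}{\zeta(t)-m(t)}\,I .$$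
   Context: $\mathrm{BUC}(X)$ is the set of bounded uniformly continuous real functions on $X$. $C_0([0,\infty);\mathbb{R})$ is the set of continuous $\zeta:[0,\infty)\to\mathbb{R}$ with $\zeta(0)=0$, and $C^1_0([0,\infty))$ is its subset of $C^1$ paths. $I$ is the $d\times d$ identity matrix, and matrix inequalities are in the sense of symmetric matrices. ''$H\in C^2(\mathbb{R}^d)$ is uniformly convex'' means that there exist $\Theta,\theta>0$ such that $\theta I\le D^2H(p)\le\Theta I$ for all $p\in\mathbb{R}^d$. $F(p)=\sqrt{D^2H(p)}$ is the positive definite symmetric square root. $H$ is called quadratic if there exists a symmetric matrix $A$ with $\theta I\le A\le\Theta I$ for some $\theta,\Theta>0$ such that $H(p)=(Ap,p)$ for all $p$. Pathwise (stochastic) viscosity solutions: for convex $H$ the solution operator is the unique continuous extension, in the path, of the classical viscosity solution operator for smooth paths. That is, $u$ is the pathwise solution of $du=H(Du)\cdot d\zeta$ with initial datum $u_0\in\mathrm{BUC}(\mathbb{R}^d)$ if, whenever $\zeta_n\in C_0^1([0,\infty))$ converge to $\zeta$ locally uniformly on $[0,\infty)$ and $u_{0,n}\in \mathrm{BUC}(\mathbb{R}^d)$ converge to $u_0$ uniformly, the (Crandall-Lions) viscosity solutions $u_n$ of $u_{n,t}=H(Du_n)\dot\zeta_n$ with $u_n(\cdot,0)=u_{0,n}$ converge to $u$ uniformly on $\mathbb{R}^d\times[0,T]$ for every $T>0$. It is known that such a solution exists and is unique. For a continuous $v:\mathbb{R}^d\to\mathbb{R}$ and a constant $K$, the inequality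 $-F(Dv)D^2vF(Dv)\le K I$ (resp. $\ge -KI$) holds in the viscosity sense if, for every smooth $\phi$ and every maximum (resp. minimum) point $x_0$ of $v-\phi$, $-F(D\phi(x_0))D^2\phi(x_0)F(D\phi(x_0))\le K I$ (resp. $\ge -KI$). When a denominator vanishes, the corresponding quotient is $+\infty$ and that inequality is void. *)

(* Defs.v *)
From HB Require Import structures.
From mathcomp Require Import all_boot all_order all_algebra.
From mathcomp Require Import all_classical all_reals all_analysis.

Set Implicit Arguments.
Unset Strict Implicit.
Unset Printing Implicit Defensive.

Import Order.TTheory GRing.Theory Num.Theory.
Import numFieldNormedType.Exports.

Local Open Scope classical_set_scope.
Local Open Scope ring_scope.

(* Points of R^d are row vectors.  Functions on [0, +oo[ or R^d x [0, +oo[ are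
   total functions on R or R^d x R; only their values at times t >= 0 matter. *)

(** * Differential calculus *)

(* C^k through directional derivatives along every vector, at every order; on
   a finite-dimensional space this is the usual notion. *)
Fixpoint Ck (R : realType) (V : normedModType R) (k : nat) (f : V -> R^o)
    : Prop :=
  continuous f /\
  if k is k'.+1 then
    forall v : V, (forall x, derivable f x v) /\ Ck k' ('D_v f)
  else True.

Definition smooth (R : realType) (V : normedModType R) (f : V -> R^o) : Prop :=
  forall k, Ck k f.

Definition basis_vec (R : realType) (d : nat) (i : 'I_d) : 'rV[R]_d :=
  delta_mx 0 i.

Definition grad (R : realType) (d : nat) (f : 'rV[R]_d -> R^o) (x : 'rV[R]_d)
    : 'rV[R]_d :=
  \row_(i < d) 'D_(basis_vec R i) f x.

Definition hess (R : realType) (d : nat) (f : 'rV[R]_d -> R^o) (x : 'rV[R]_d)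
    : 'M[R]_d :=
  \matrix_(i < d, j < d) 'D_(basis_vec R i) ('D_(basis_vec R j) f) x.

(** * Symmetric matrices *)

(* (A p, p), for p a row vector *)
Definition qform (R : realType) (d : nat) (A : 'M[R]_d) (p : 'rV[R]_d) : R :=
  (p *m A *m p^T) 0 0.

Definition lemx (R : realType) (d : nat) (A B : 'M[R]_d) : Prop :=
  forall v : 'rV[R]_d, qform A v <= qform B v.

Definition is_spd_sqrt (R : realType) (d : nat) (A B : 'M[R]_d) : Prop :=
  [/\ B^T = B, forall v : 'rV[R]_d, v != 0 -> 0 < qform B v & B *m B = A].

(* The positive definite symmetric square root (0 if there is none). *)
Definition sqrtmx (R : realType) (d : nat) (A : 'M[R]_d) : 'M[R]_d :=
  xget 0 [set B | is_spd_sqrt A B].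

(** * Hamiltonians *)

Definition uniformly_convex (R : realType) (d : nat) (H : 'rV[R]_d -> R)
    : Prop :=
  Ck 2 H /\
  exists theta Theta : R, [/\ 0 < theta, 0 < Theta &
    forall p, lemx theta%:M (hess H p) /\ lemx (hess H p) Theta%:M].

Definition quadratic (R : realType) (d : nat) (H : 'rV[R]_d -> R) : Prop :=
  exists A : 'M[R]_d, [/\ A^T = A,
    exists theta Theta : R, [/\ 0 < theta, 0 < Theta,
      lemx theta%:M A & lemx A Theta%:M] &
    forall p, H p = qform A p].

Definition Froot (R : realType) (d : nat) (H : 'rV[R]_d -> R) (p : 'rV[R]_d)
    : 'M[R]_d :=
  sqrtmx (hess H p).

(** * Function spaces *)

(* The uniformity of [subspace A] restricts that of V to A, and is discrete off
   A: this is uniform continuity of f on A. *)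
Definition BUC (R : realType) (V : normedModType R) (A : set V) (f : V -> R)
    : Prop :=
  (exists K : R, forall x, A x -> `|f x| <= K) /\
  unif_continuous (f : subspace A -> R).

Definition halfspace (R : realType) (d : nat) : set ('rV[R]_d * R) :=
  [set z | 0 <= z.2].

Definition strip (R : realType) (d : nat) (T : R) : set ('rV[R]_d * R) :=
  [set z | 0 <= z.2 <= T].

Definition C0_path (R : realType) (zeta : R -> R) : Prop :=
  zeta 0 = 0 /\ {within `[0, +oo[, continuous zeta}.

(* The derivative at 0 is one-sided. *)
Definition C01_path (R : realType) (zeta : R -> R) : Prop :=
  C0_path zeta /\
  exists dzeta : R -> R, [/\ {within `[0, +oo[, continuous dzeta},
    forall t : R, 0 < t -> is_derive t 1 zeta (dzeta t) &
    h^-1 * (zeta h - zeta 0) @[h --> 0^'+] --> dzeta 0].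

(** * Viscosity solutions of u_t = H(Du) zeta'(t) in R^d x (0, +oo) *)

Definition visc_subsolution (R : realType) (d : nat) (H : 'rV[R]_d -> R)
    (zeta : R -> R) (u : 'rV[R]_d * R -> R) : Prop :=
  forall phi : 'rV[R]_d * R -> R, Ck 1 phi ->
  forall (x0 : 'rV[R]_d) (t0 : R), 0 < t0 ->
    (\forall z \near (x0, t0), u z - phi z <= u (x0, t0) - phi (x0, t0)) ->
    derive1 (fun t => phi (x0, t)) t0
      <= H (grad (fun x => phi (x, t0)) x0) * derive1 zeta t0.

Definition visc_supersolution (R : realType) (d : nat) (H : 'rV[R]_d -> R)
    (zeta : R -> R) (u : 'rV[R]_d * R -> R) : Prop :=
  forall phi : 'rV[R]_d * R -> R, Ck 1 phi ->
  forall (x0 : 'rV[R]_d) (t0 : R), 0 < t0 ->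
    (\forall z \near (x0, t0), u (x0, t0) - phi (x0, t0) <= u z - phi z) ->
    H (grad (fun x => phi (x, t0)) x0) * derive1 zeta t0
      <= derive1 (fun t => phi (x0, t)) t0.

(* Solutions are taken in the class where the Cauchy problem is well posed:
   BUC(R^d x [0, T]) for every T. *)
Definition visc_solution (R : realType) (d : nat) (H : 'rV[R]_d -> R)
    (zeta : R -> R) (u0 : 'rV[R]_d -> R) (u : 'rV[R]_d * R -> R) : Prop :=
  [/\ forall T : R, 0 < T -> BUC (@strip R d T) u,
      visc_subsolution H zeta u,
      visc_supersolution H zeta u &
      forall x, u (x, 0) = u0 x].

(** * Pathwise viscosity solutions of du = H(Du) . dzeta *)

Definition pathwise_solution (R : realType) (d : nat) (H : 'rV[R]_d -> R)
    (zeta : R -> R) (u0 : 'rV[R]_d -> R) (u : 'rV[R]_d * R -> R) : Prop :=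
  forall (zeta_ : nat -> R -> R) (u0_ : nat -> 'rV[R]_d -> R)
    (u_ : nat -> 'rV[R]_d * R -> R),
    (forall n, C01_path (zeta_ n)) ->
    (forall T : R, 0 < T -> {uniform `[0, T], zeta_ @ \oo --> zeta}) ->
    (forall n, BUC [set: 'rV[R]_d] (u0_ n)) ->
    {uniform [set: 'rV[R]_d], u0_ @ \oo --> u0} ->
    (forall n, visc_solution H (zeta_ n) (u0_ n) (u_ n)) ->
    forall T : R, 0 < T ->
      {uniform @strip R d T, u_ @ \oo --> u}.

(** * Viscosity bounds on -F(Dv) D^2v F(Dv) *)

Definition visc_hess_le (R : realType) (d : nat) (F : 'rV[R]_d -> 'M[R]_d)
    (v : 'rV[R]_d -> R) (K : R) : Prop :=
  forall phi : 'rV[R]_d -> R, smooth phi ->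
  forall x0 : 'rV[R]_d, (forall x, v x - phi x <= v x0 - phi x0) ->
    lemx (- (F (grad phi x0) *m hess phi x0 *m F (grad phi x0))) K%:M.

Definition visc_hess_ge (R : realType) (d : nat) (F : 'rV[R]_d -> 'M[R]_d)
    (v : 'rV[R]_d -> R) (K : R) : Prop :=
  forall phi : 'rV[R]_d -> R, smooth phi ->
  forall x0 : 'rV[R]_d, (forall x, v x0 - phi x0 <= v x - phi x) ->
    lemx K%:M (- (F (grad phi x0) *m hess phi x0 *m F (grad phi x0))).

(** * Running extrema of a path *)

Definition run_max (R : realType) (zeta : R -> R) (t : R) : R :=
  sup (zeta @` `[0, t]).

Definition run_min (R : realType) (zeta : R -> R) (t : R) : R :=
  inf (zeta @` `[0, t]).

(* Main.v *)
Require Import Defs.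
From mathcomp Require Import all_boot all_order all_algebra.
From mathcomp Require Import all_classical all_reals all_analysis.
From mathcomp Require Import ring lra.

(** Write L for the Legendre dual of H.  Along a piece of path on which zeta
    increases by a, the equation is solved by the Hopf-Lax formula
    T_a u (x) = sup_q (u (x + a q) - a L q), and along a piece on which zeta
    decreases by b by the dual formula S_b u (x) = inf_q (u (x - b q) + b L q).

    The integrated form of the bound - F(Du) D^2u F(Du) <= 1/a is that u lies
    in the range of T_a: then at every point the graph of u is touched from
    below, globally, by a translate of - a L(- . / a), whose second derivatives
    are those of the bound because D^2 L is the inverse of D^2 H = F^2.  A test
    function that touches u from above also lies above that translate, which
    gives the viscosity inequality (touching_visc_hess_le).

    By the semigroup property, T_h maps the range of T_a into the range of
    T_(a+h).  The main point is that S_b maps the range of T_a into the range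
    of T_(a-b) when b < a (hopf_inf_of_sup).  An optimal z in the formula for
    S_b (T_a v) at x is a point where u = T_a v is touched from below by a
    translate of - b L(- . / b).  The claim is that the flatter translate of
    - a L(- . / a) with the same slope at z also stays below u.  Since u is
    touched at every point by such flatter translates, this is a comparison of
    two of them, and it works when mixed second differences of L are comparable
    to a fixed bilinear form: for quadratic H they are equal to one, and in one
    dimension L'' lies between two positive constants.

    Consequently, if a path goes up and down in finitely many monotone steps,
    the solution at the final time lies in the range of T_a, where a is the
    distance from the final value to the smallest earlier value of the path
    (hopf_state_range).  Such step paths, smoothed so as to be C^1, approximate
    zeta uniformly on compact sets, and the composition of the operators T and S
    is the viscosity solution along them (hopf_flow_visc_solution), so it
    converges to u.  Belonging to the range of T_a means T_a (S_a u) = u, which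
    survives uniform limits since T_a and S_a do not increase distances.

    The lower bound is the upper bound for - u, which solves the equation with
    path - zeta and Hamiltonian H(- .). *)

Import Order.TTheory GRing.Theory Num.Theory.
Import numFieldNormedType.Exports.

Local Open Scope classical_set_scope.
Local Open Scope ring_scope.

(** * Epsilon-delta forms of limits, derivatives and uniform continuity *)

(** The balls of a subspace are the traces of the ambient balls at points of
    the set and singletons elsewhere, so points off the set impose nothing. *)
Lemma BUC_epsP {R : realType} {V : normedModType R} (A : set V) (f : V -> R) :
  BUC A f <->
  (exists K, forall x, A x -> `|f x| <= K) /\
  forall e, 0 < e -> exists2 r, 0 < r &
    forall x y, A x -> A y -> `|x - y| < r -> `|f x - f y| < e.
Proof.
split=> -[fK fuc]; split=> //.
- move=> e e0; move/unif_continuousP: fuc => /(_ e e0)[r /= r0 rP].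
  exists r => // x y Ax Ay xy; apply: (rP (x, y)) => /=.
  rewrite ball_subspace_ball /subspace_ball; case: ifPn => [_|/negP[]].
  + by split => //; rewrite -ball_normE.
  + by rewrite inE.
- apply/unif_continuousP => e /= e0; have [r r0 rP] := fuc e e0.
  exists r => // -[x y] /=.
  rewrite ball_subspace_ball /subspace_ball; case: ifPn => [|_ ->].
  + by rewrite inE => Ax [Ay]; rewrite -ball_normE => xy; exact: rP.
  + exact: ballxx.
Qed.

Lemma uniform_epsP {R : realType} {T : choiceType} (A : set T) (u_ : nat -> T -> R) (u : T -> R) :
  {uniform A, u_ @ \oo --> u} <->
  forall e, 0 < e -> exists N, forall n, (N <= n)%N ->
    forall x, A x -> `|u x - u_ n x| < e.
Proof.
split=> [cu e e0|cu].
- have /cu[N _ NP] : nbhs (u : {uniform` A -> R})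
      [set h | forall y, A y -> `|u y - h y| < e].
    apply/uniform_nbhs; exists [set xy | `|xy.1 - xy.2| < e]; split=> //.
    by rewrite -entourage_ballE; exists e => // xy; rewrite /= -ball_normE.
  by exists N => n Nn; exact: NP.
- move=> P /uniform_nbhs[E [/= ]]; rewrite -entourage_ballE => -[e /= e0 eE] EP.
  have [N NP] := cu e e0; exists N => // n /= Nn.
  by apply: EP => y Ay; apply: eE; rewrite -ball_normE; exact: NP.
Qed.

Lemma is_derive_epsP {R : realType} {V : normedModType R} (f : V -> R) (x v : V) (l : R) :
  is_derive x v (f : V -> R^o) l <->
  forall e, 0 < e -> exists2 r, 0 < r &
    forall h : R, `|h| < r -> `|f (x + h *: v) - f x - h * l| <= e * `|h|.
Proof.
have fieldE (h Y X m : R) : h != 0 -> Y - X - h * m = - ((m - h^-1 * (Y - X)) * h).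
  by move=> h0; field.
have key h m : h != 0 -> f (x + h *: v) - f x - h * m =
    - ((m - h^-1 *: ((f \o shift x) (h *: v) - f x)) * h).
  by move=> h0 /=; rewrite [h *: v + x]addrC; exact: fieldE.
split=> [[dfx <-] e e0|H].
- move: dfx; rewrite /derivable => /cvgrPdist_le /(_ e e0) [r /= r0 rP].
  exists r => // h hr.
  have [->|h0] := eqVneq h 0.
    by rewrite scale0r addr0 subrr mul0r subrr normr0 mulr0.
  have := rP h; rewrite /= sub0r normrN => /(_ hr h0) le_e.
  rewrite key//.
  by rewrite normrN normrM ler_wpM2r.
- have cl : (fun h : R => h^-1 *: ((f \o shift x) (h *: v) - f x)) @ 0^' --> l.
    apply/cvgrPdist_le => e e0; have [r r0 rP] := H e e0.
    exists r => // h /=; rewrite sub0r normrN => hr h0.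
    have := rP h hr; rewrite key// normrN normrM.
    by rewrite ler_pM2r ?normr_gt0.
  by split; [apply/cvg_ex; exists l|exact/cvg_lim].
Qed.

Lemma continuous_epsP {R : realType} {V : normedModType R} (f : V -> R) x :
  {for x, continuous f} <->
  forall e, 0 < e -> exists2 r, 0 < r &
    forall y, `|y - x| < r -> `|f y - f x| <= e.
Proof.
split=> [cf e e0|H].
- move/cvgrPdist_le: cf => /(_ e e0)/nbhs_ballP[r /= r0 rP].
  exists r => // y yx; rewrite distrC; apply: rP.
  by rewrite -ball_normE /= distrC.
- apply/cvgrPdist_le => e e0; have [r r0 rP] := H e e0.
  apply/nbhs_ballP; exists r => // y; rewrite -ball_normE /= => xy.
  by rewrite distrC; apply: rP; rewrite distrC.
Qed.

Lemma BUC_setTP {R : realType} {V : normedModType R} (f : V -> R) :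
  BUC [set: V] f <->
  (exists K, forall x, `|f x| <= K) /\
  forall e, 0 < e -> exists2 r, 0 < r &
    forall x y, `|x - y| < r -> `|f x - f y| < e.
Proof.
rewrite BUC_epsP; split=> -[[K fK] fuc]; split=> //.
- by exists K => x; exact: fK.
- by move=> e /fuc[r r0 rP]; exists r => // x y; exact: rP.
- by exists K.
- by move=> e /fuc[r r0 rP]; exists r => // x y _ _; exact: rP.
Qed.

Lemma BUC_continuous {R : realType} {V : normedModType R} (f : V -> R) :
  BUC [set: V] f -> continuous f.
Proof.
move=> /BUC_setTP[_ fuc] x; apply/continuous_epsP => e /fuc[r r0 rP].
by exists r => // y yx; exact/ltW/rP.
Qed.

Lemma BUC_opp {R : realType} {V : normedModType R} (A : set V) (f : V -> R) :
  BUC A f -> BUC A (fun x => - f x).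
Proof.
move=> /BUC_epsP[[K fK] fuc]; apply/BUC_epsP; split.
  by exists K => x Ax; rewrite normrN fK.
move=> e /fuc[r r0 rP]; exists r => // x y Ax Ay xy.
by rewrite -opprD normrN; exact: rP.
Qed.

(** * The Euclidean product and Legendre pairs *)

Definition dotv {R : realType} {d : nat} (p q : 'rV[R]_d) : R := (p *m q^T) 0 0.

Section dotv_theory.
Context {R : realType} {d : nat}.
Implicit Types (p q : 'rV[R]_d) (a : R).

Lemma dotvE p q : dotv p q = \sum_i p 0 i * q 0 i.
Proof. by rewrite /dotv mxE; apply: eq_bigr => i _; rewrite mxE. Qed.

Lemma dotvDl p p' q : dotv (p + p') q = dotv p q + dotv p' q.
Proof. by rewrite /dotv mulmxDl mxE. Qed.

Lemma dotvDr p q q' : dotv p (q + q') = dotv p q + dotv p q'.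
Proof. by rewrite /dotv linearD mulmxDr mxE. Qed.

Lemma dotvZl a p q : dotv (a *: p) q = a * dotv p q.
Proof. by rewrite /dotv -scalemxAl mxE. Qed.

Lemma dotvZr a p q : dotv p (a *: q) = a * dotv p q.
Proof. by rewrite /dotv linearZ -scalemxAr mxE. Qed.

Lemma dotvNl p q : dotv (- p) q = - dotv p q.
Proof. by rewrite -scaleN1r dotvZl mulN1r. Qed.

Lemma dotvNr p q : dotv p (- q) = - dotv p q.
Proof. by rewrite -scaleN1r dotvZr mulN1r. Qed.

Lemma dotv0l q : dotv 0 q = 0.
Proof. by rewrite -(scale0r 0) dotvZl mul0r. Qed.

Lemma dotv0r q : dotv q 0 = 0.
Proof. by rewrite -(scale0r 0) dotvZr mul0r. Qed.

Lemma dotvC p q : dotv p q = dotv q p.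
Proof. by rewrite !dotvE; apply: eq_bigr => i _; rewrite mulrC. Qed.

Lemma dotv_mulmx p q (M : 'M[R]_d) : dotv (p *m M) q = dotv p (q *m M^T).
Proof. by rewrite /dotv trmx_mul trmxK mulmxA. Qed.

Lemma dotv_ge0 p : 0 <= dotv p p.
Proof. by rewrite dotvE sumr_ge0// => i _; rewrite -expr2 sqr_ge0. Qed.

Lemma dotv_eq0 p : dotv p p = 0 -> p = 0.
Proof.
rewrite dotvE => /eqP; rewrite psumr_eq0 => [/allP p0|i _]; last by rewrite -expr2 sqr_ge0.
apply/rowP => i; have := p0 i (mem_index_enum i).
by rewrite /= mulf_eq0 orbb mxE => /eqP.
Qed.

Lemma qform_dotv (M : 'M[R]_d) p : qform M p = dotv (p *m M) p.
Proof. by []. Qed.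

Lemma qform_scalar a p : qform a%:M p = a * dotv p p.
Proof. by rewrite qform_dotv mul_mx_scalar dotvZl. Qed.

Lemma dotv_deltal i q : dotv (delta_mx 0 i) q = q 0 i.
Proof. by rewrite /dotv -rowE !mxE. Qed.

Lemma normr_row_le q (M : R) : 0 <= M ->
  (forall i, `|q 0 i| <= M) -> `|q| <= M.
Proof.
move=> M0 qM; rewrite [leLHS]/Num.norm /= mx_normrE.
by apply: bigmax_le => // -[i j] _ /=; rewrite (ord1 i).
Qed.

Lemma normr_row_ge q i : `|q 0 i| <= `|q|.
Proof.
rewrite [leRHS]/Num.norm /= mx_normrE.
by apply: (le_bigmax _ (fun ij : 'I_1 * 'I_d => `|q ij.1 ij.2|) (0, i)).
Qed.

Lemma normr_delta_le i : `|delta_mx 0 i : 'rV[R]_d| <= 1.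
Proof.
apply: normr_row_le => // j; rewrite mxE eqxx /=.
by case: (j == i); rewrite ?normr1 ?normr0.
Qed.

Lemma normr_dotv p q : `|dotv p q| <= d%:R * `|p| * `|q|.
Proof.
rewrite dotvE (le_trans (ler_norm_sum _ _ _))//.
rewrite (le_trans (ler_sum _ (G := fun=> `|p| * `|q|) _))//.
  by move=> i _; rewrite normrM ler_pM// normr_row_ge.
by rewrite sumr_const card_ord -[leLHS]mulr_natl mulrA.
Qed.

Lemma normr_mulmx (B : 'M[R]_d) :
  exists2 K, 0 <= K & forall q, `|q *m B| <= K * `|q|.
Proof.
exists (\sum_i \sum_j `|B i j|).
  by apply: sumr_ge0 => i _; apply: sumr_ge0.
move=> q; apply: normr_row_le => [|j].
  by rewrite mulr_ge0// sumr_ge0// => i _; apply: sumr_ge0.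
rewrite mxE (le_trans (ler_norm_sum _ _ _))// mulr_suml ler_sum// => i _.
rewrite normrM mulrC ler_pM ?normr_row_ge//.
by rewrite (bigD1 j)//= lerDl sumr_ge0.
Qed.

End dotv_theory.

Lemma closed_ball0_compact {R : realType} {d : nat} (r : R) :
  compact [set q : 'rV[R]_d | `|q| <= r].
Proof.
apply: bounded_closed_compact.
- exists r; split; first exact: num_real.
  by move=> x rx q /= qr; rewrite (le_trans qr)// ltW.
- rewrite [X in closed X](_ : _ = (fun q : 'rV[R]_d => `|q|) @^-1` [set x | x <= r])//.
  apply: closed_comp; first by move=> q _; exact: norm_continuous.
  exact: closed_le.
Qed.

Definition mixed_diff {R : realType} {d : nat} (L : 'rV[R]_d -> R) (q k r : 'rV[R]_d) : R :=
  L (q + k + r) - L (q + k) - L (q + r) + L q.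

(** L is the convex dual of H, both suprema being attained.  The last field
    compares the mixed second differences of L with one bilinear form: in one
    dimension, with B = 1, it says that L'' lies between c and C, and for
    quadratic H the matrix B is the inverse of that of H and c = C.  The
    restriction to d = 1 or to quadratic H enters through this field. *)
Record legendre_pair {R : realType} {d : nat} (H L : 'rV[R]_d -> R)
    (B : 'M[R]_d) (c C : R) : Prop := LegendrePair {
  fenchel : forall p q, dotv p q <= H p + L q ;
  legendre_velocity : forall p, exists q, dotv p q = H p + L q ;
  legendre_momentum : forall q, exists p, dotv p q = H p + L q ;
  hamiltonian_continuous : continuous H ;
  mixed_form_ge0 : forall r, 0 <= dotv (r *m B) r ;
  mixed_lower_gt0 : 0 < c ;
  mixed_diff_bounds : forall q k r, 0 <= dotv (k *m B) r ->
    c * dotv (k *m B) r <= mixed_diff L q k r <= C * dotv (k *m B) r }.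

Arguments fenchel {R d H L B c C}.
Arguments legendre_velocity {R d H L B c C}.
Arguments legendre_momentum {R d H L B c C}.
Arguments hamiltonian_continuous {R d H L B c C}.
Arguments mixed_form_ge0 {R d H L B c C}.
Arguments mixed_lower_gt0 {R d H L B c C}.
Arguments mixed_diff_bounds {R d H L B c C}.

Section legendre_pair_theory.
Context {R : realType} {d : nat} {H L : 'rV[R]_d -> R} {B : 'M[R]_d} {c C : R}.
Hypothesis HL : legendre_pair H L B c C.
Implicit Types (p q r x y : 'rV[R]_d) (a b e : R).

Lemma legendre_pair_opp : legendre_pair (H \o -%R) (L \o -%R) B c C.
Proof.
case: HL => Hf Hv Hm Hc B0 c0 Hx; split=> //=.
- by move=> p q; rewrite -[dotv p q]opprK -dotvNl -dotvNr; exact: Hf.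
- move=> p; have [q pq] := Hv (- p); exists (- q).
  by rewrite opprK -pq dotvNl dotvNr.
- move=> q; have [p pq] := Hm (- q); exists (- p).
  by rewrite opprK -pq dotvNl dotvNr.
- by move=> x; apply: continuous_comp; [exact: opp_continuous|exact: Hc].
- move=> q k r; have := Hx (- q) (- k) (- r).
  by rewrite mulNmx dotvNl dotvNr opprK /mixed_diff /= !opprD.
Qed.

(** Shifting the momentum p by e along each coordinate axis, in both
    directions, turns a bound on H near p into a bound on the sup norm of q. *)
Lemma fenchel_ball p q e M : 0 <= e -> H p <= M ->
    (forall i, H (p + e *: delta_mx 0 i) <= M) ->
    (forall i, H (p - e *: delta_mx 0 i) <= M) ->
  e * `|q| <= L q - dotv p q + M.
Proof.
move=> e0 HM HpM HmM.
have M0 : 0 <= L q - dotv p q + M by have := fenchel HL p q; lra.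
have -> : e * `|q| = `|e *: q| by rewrite normrZ ger0_norm.
apply: normr_row_le => // i; rewrite mxE ler_norml; apply/andP; split.
- have := fenchel HL (p - e *: delta_mx 0 i) q.
  by rewrite dotvDl dotvNl dotvZl dotv_deltal; have := HmM i; lra.
- have := fenchel HL (p + e *: delta_mx 0 i) q.
  by rewrite dotvDl dotvZl dotv_deltal; have := HpM i; lra.
Qed.

Lemma lagrangian_superlinear (N : R) : 0 <= N ->
  exists2 M, 0 <= M & forall q, N * `|q| <= L q + M.
Proof.
move=> N0; pose S := \sum_i (`|H (0 + N *: delta_mx 0 i)| + `|H (0 - N *: delta_mx 0 i)|).
have S0 : 0 <= S by apply: sumr_ge0 => i _; rewrite addr_ge0.
have SE i : `|H (0 + N *: delta_mx 0 i)| + `|H (0 - N *: delta_mx 0 i)| <= S.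
  by rewrite /S (bigD1 i)//= lerDl sumr_ge0// => j _; rewrite addr_ge0.
have H0 := normr_ge0 (H 0).
exists (`|H 0| + S); first by rewrite addr_ge0.
move=> q; rewrite -[L q]subr0 -[X in L q - X](dotv0l q).
apply: fenchel_ball => //; first by have := ler_norm (H 0); lra.
- move=> i; have := SE i; have := normr_ge0 (H (0 - N *: delta_mx 0 i)).
  by have := ler_norm (H (0 + N *: delta_mx 0 i)); lra.
- move=> i; have := SE i; have := normr_ge0 (H (0 + N *: delta_mx 0 i)).
  by have := ler_norm (H (0 - N *: delta_mx 0 i)); lra.
Qed.

Lemma legendre_subgradient p q q' : dotv p q = H p + L q ->
  L q + dotv p (q' - q) <= L q'.
Proof.
by move=> pq; have := fenchel HL p q'; rewrite dotvDr dotvNr; lra.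
Qed.

(** The mixed difference with base point q - r and both increments equal to r
    is a centred second difference; the subgradient inequality bounds L (q - r)
    in it. *)
Lemma legendre_upper p q r : dotv p q = H p + L q ->
  L (q + r) <= L q + dotv p r + C * dotv (r *m B) r.
Proof.
move=> pq.
have /andP[_] := mixed_diff_bounds HL (q - r) r r (mixed_form_ge0 HL r).
rewrite /mixed_diff subrK.
have := legendre_subgradient p q (q - r) pq.
by rewrite addrAC subrr add0r dotvNr; lra.
Qed.

Lemma lagrangian_continuous : continuous L.
Proof.
move=> q; apply/continuous_epsP => e e0.
have [p pq] := legendre_momentum HL q.
have [K K0 KB] := normr_mulmx B.
set M := d%:R * `|p| + `|C| * (d%:R * K) + 1.
have M1 : 1 <= M by rewrite lerDr addr_ge0// !mulr_ge0.
exists (Num.min 1 (e / M)).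
  by rewrite lt_min ltr01 divr_gt0// (lt_le_trans ltr01).
move=> y; rewrite lt_min => /andP[y1 yM].
have := legendre_subgradient p q y pq; have := legendre_upper p q (y - q) pq.
rewrite addrC subrK.
have := normr_dotv p (y - q); have := normr_dotv ((y - q) *m B) (y - q).
move: (dotv p _) (dotv (_ *m B) _) => s t.
set n := `|y - q| in y1 yM *; have n0 : 0 <= n by rewrite /n.
have nB : `|(y - q) *m B| <= K * n := KB _.
move=> ht hs hu hl.
have ht' : `|C * t| <= `|C| * (d%:R * K) * n.
  rewrite normrM -mulrA ler_wpM2l// (le_trans ht)//.
  rewrite -!mulrA ler_wpM2l//; apply: (@le_trans _ _ (K * n * n)).
    by rewrite mulrC [leRHS]mulrC ler_wpM2l.
  by rewrite ler_piMr// ?mulr_ge0// ltW.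
have Me : M * n <= e.
  by rewrite mulrC -ler_pdivlMr ?ltW// (lt_le_trans ltr01).
have hC := ler_norm (C * t); have hs1 := ler_norm s; have := ler_norm (- s).
rewrite normrN ler_norml => hs2.
have C0 := normr_ge0 (C * t).
have : `|s| + `|C * t| <= e.
  rewrite (le_trans (lerD hs ht'))// (le_trans _ Me)// /M.
  by rewrite !mulrDl lerDl mul1r.
by move=> hh; apply/andP; split; lra.
Qed.

(** L lies above its tangents, here above the one at the barycentre. *)
Lemma lagrangian_convex a b q q' : 0 <= a -> 0 <= b -> 0 < a + b ->
  (a + b) * L ((a + b)^-1 *: (a *: q + b *: q')) <= a * L q + b * L q'.
Proof.
move=> a0 b0 ab0; set z := _ *: _.
have [p pz] := legendre_momentum HL z.
have Hq := legendre_subgradient p z q pz.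
have Hq' := legendre_subgradient p z q' pz.
have zE : (a + b) * dotv p z = a * dotv p q + b * dotv p q'.
  by rewrite -dotvZr /z scalerA divff ?gt_eqF// scale1r dotvDr !dotvZr.
rewrite !dotvDr !dotvNr in Hq Hq'.
have := ler_wpM2l a0 Hq; have := ler_wpM2l b0 Hq'; nra.
Qed.

End legendre_pair_theory.

(** * Hopf-Lax operators *)

(** Hopf-Lax formula for u_t = H(Du) at time a, parametrized by the velocity q
    of the straight characteristic through x, so that a = 0 is not special. *)
Definition hopf_sup {R : realType} {d : nat} (L : 'rV[R]_d -> R) (a : R) (u : 'rV[R]_d -> R)
    (x : 'rV[R]_d) : R :=
  sup (range (fun q => u (x + a *: q) - a * L q)).

(** Hopf-Lax formula for u_t = - H(Du).  Passing to - u exchanges it with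
    [hopf_sup] and reflects momenta and velocities. *)
Definition hopf_inf {R : realType} {d : nat} (L : 'rV[R]_d -> R) (a : R) (u : 'rV[R]_d -> R)
    (x : 'rV[R]_d) : R :=
  - hopf_sup (L \o -%R) a (fun y => - u y) x.

Section hopf_sup_theory.
Context {R : realType} {d : nat} {H L : 'rV[R]_d -> R} {B : 'M[R]_d} {c C : R}.
Hypothesis HL : legendre_pair H L B c C.
Implicit Types (p q r x y : 'rV[R]_d) (a b e : R) (u v w : 'rV[R]_d -> R).
Local Notation V := 'rV[R]_d.
Local Notation T := (hopf_sup L).

(** L grows at least linearly and u is bounded, so only velocities of a compact
    ball compete. *)
Lemma hopf_attained_max a u x : 0 <= a -> BUC [set: V] u ->
  exists q, forall q', u (x + a *: q') - a * L q' <= u (x + a *: q) - a * L q.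
Proof.
move=> a0 bu; have cu := BUC_continuous _ bu.
have := bu => /BUC_setTP[[K uK] _].
move: a0; rewrite le_eqVlt => /predU1P[<-|a0].
  by exists 0 => q'; rewrite !scale0r !mul0r.
have [M M0 LM] := lagrangian_superlinear HL 1 ler01.
pose r := `|2 * K / a + L 0 + M|.
have cf : continuous (fun q => u (x + a *: q) - a * L q).
  move=> q.
  apply: (@continuousB R R^o V (fun q => u (x + a *: q)) (fun q => a * L q)).
    apply: continuous_comp; last exact: cu.
    apply: (@continuousD R V V (fun=> x) (fun q => a *: q)).
      exact: cst_continuous.
    exact: scaler_continuous.
  apply: (@continuousM R V (fun=> a) L); first exact: cst_continuous.
  exact: lagrangian_continuous HL _.
have A0 : [set q : V | `|q| <= r] !=set0 by exists 0; rewrite /= normr0 /r.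
have [q _ qmax] := EVT_max_rV A0 (closed_ball0_compact r) (continuous_subspaceT cf).
exists q => q'.
have [q'r|rq'] := leP `|q'| r; first by apply: qmax; rewrite inE.
have := qmax 0; rewrite inE /= normr0 /r normr_ge0 => /(_ isT).
apply: le_trans; rewrite scaler0 addr0.
have := LM q'; rewrite mul1r => Lq'.
have {rq'}: 2 * K / a + L 0 + M < `|q'| by exact: le_lt_trans (ler_norm _) rq'.
move=> h; have {h}: 2 * K / a + L 0 <= L q' by lra.
rewrite -(ler_pM2l a0) mulrDr mulrCA divff ?gt_eqF// mulr1.
have := uK x; have := uK (x + a *: q'); rewrite !ler_norml; lra.
Qed.

Lemma hopf_sup_ub a u x q : 0 <= a -> BUC [set: V] u ->
  u (x + a *: q) - a * L q <= T a u x.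
Proof.
move=> a0 bu; have [q1 q1P] := hopf_attained_max a u x a0 bu.
apply: ub_le_sup; last by exists q.
by exists (u (x + a *: q1) - a * L q1) => _ [q' _ <-]; exact: q1P.
Qed.

Lemma hopf_sup_le a u x M : (forall q, u (x + a *: q) - a * L q <= M) -> T a u x <= M.
Proof.
move=> uM; apply: ge_sup; first by exists (u (x + a *: 0) - a * L 0), 0.
by move=> _ [q _ <-].
Qed.

Lemma hopf_sup_attained a u x : 0 <= a -> BUC [set: V] u ->
  exists q, T a u x = u (x + a *: q) - a * L q.
Proof.
move=> a0 bu; have [q qP] := hopf_attained_max a u x a0 bu; exists q.
by apply/eqP; rewrite eq_le hopf_sup_le//= hopf_sup_ub.
Qed.

(** Monotonicity, commutation with constants and commutation with translations
    in one inequality: it yields both nonexpansiveness and the preservation of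
    moduli of continuity. *)
Lemma hopf_sup_leD a u v x y e : 0 <= a -> BUC [set: V] v ->
  (forall h, u (x + h) <= v (y + h) + e) -> T a u x <= T a v y + e.
Proof.
move=> a0 bv uv; apply: hopf_sup_le => q.
have := hopf_sup_ub a v y q a0 bv; have := uv (a *: q); lra.
Qed.

Lemma hopf_sup0 u : T 0 u = u.
Proof.
apply/funext => x; rewrite /hopf_sup.
have -> : range (fun q => u (x + 0 *: q) - 0 * L q) = [set u x].
  apply/seteqP; split=> [_ [q _ <-]|_ ->] /=.
    by rewrite scale0r addr0 mul0r subr0.
  by exists 0 => //; rewrite scale0r addr0 mul0r subr0.
exact: sup1.
Qed.

Lemma BUC_hopf_sup a u : 0 <= a -> BUC [set: V] u -> BUC [set: V] (T a u).
Proof.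
move=> a0 bu; have := bu => /BUC_setTP[[K uK] uuc]; apply/BUC_setTP; split.
- exists (K + a * `|L 0| + a * `|H 0|) => x.
  have hL : - `|L 0| <= L 0 <= `|L 0| by rewrite -ler_norml.
  have hH : - `|H 0| <= H 0 <= `|H 0| by rewrite -ler_norml.
  have hK y : - K <= u y <= K by rewrite -ler_norml.
  rewrite ler_norml; apply/andP; split.
  + apply: le_trans (hopf_sup_ub a u x 0 a0 bu).
    rewrite scaler0 addr0; have := hK x; move: hL hH; nra.
  + apply: hopf_sup_le => q; have := fenchel HL 0 q; rewrite dotv0l.
    have := hK (x + a *: q); move: hL hH; nra.
- move=> e e0; have [r r0 rP] := uuc (e / 2) (divr_gt0 e0 (ltr0Sn _ _)).
  exists r => // x y xy.
  have key x' y' : `|x' - y'| < r -> T a u x' <= T a u y' + e / 2.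
    move=> xy'; apply: hopf_sup_leD => // h.
    have := rP (x' + h) (y' + h); rewrite opprD addrACA subrr addr0.
    by move=> /(_ xy') /ltW; rewrite ler_norml; lra.
  have := key x y xy; have := key y x; rewrite distrC => /(_ xy) h1 h2.
  apply: (@le_lt_trans _ _ (e / 2)); last lra.
  by rewrite ler_norml; apply/andP; split; lra.
Qed.

(** Two successive velocities can be replaced by their average because L is
    convex, and conversely a velocity can be used twice. *)
Lemma hopf_sup_semigroup a b u : 0 <= a -> 0 <= b -> BUC [set: V] u ->
  T a (T b u) = T (a + b) u.
Proof.
move=> a0 b0 bu; apply/funext => x; apply/eqP; rewrite eq_le.
have bTu := BUC_hopf_sup b u b0 bu.
have ab0 : 0 <= a + b by exact: addr_ge0.
apply/andP; split; apply: hopf_sup_le => q.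
- have [q' ->] := hopf_sup_attained b u (x + a *: q) b0 bu.
  move: ab0; rewrite le_eqVlt => /predU1P[ab0|ab0].
    have -> : a = 0 by lra.
    have -> : b = 0 by lra.
    by rewrite addr0 hopf_sup0 !scale0r !addr0 !mul0r !subr0.
  have := lagrangian_convex HL a b q q' a0 b0 ab0.
  have := hopf_sup_ub (a + b) u x ((a + b)^-1 *: (a *: q + b *: q')) (ltW ab0) bu.
  rewrite scalerA divff ?gt_eqF// scale1r addrA; lra.
- have := hopf_sup_ub a (T b u) x q a0 bTu.
  have := hopf_sup_ub b u (x + a *: q) q b0 bu.
  by rewrite -addrA -scalerDl; lra.
Qed.

(** Displacements larger than r cost more than the oscillation 2 K of u when a
    is small, by superlinearity of L; over smaller ones u varies little. *)
Lemma hopf_sup_small_time u e : BUC [set: V] u -> 0 < e ->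
  exists2 a0, 0 < a0 & forall a x, 0 <= a <= a0 -> `|T a u x - u x| <= e.
Proof.
move=> bu e0; have := bu => /BUC_setTP[[K uK] uuc].
have K0 : 0 <= K by exact: le_trans (normr_ge0 _) (uK 0).
have e20 : 0 < e / 2 by rewrite divr_gt0.
have [r r0 rP] := uuc _ e20.
have N0 : 0 <= 2 * K / r by rewrite divr_ge0 ?mulr_ge0// ltW.
have [M M0 LM] := lagrangian_superlinear HL (2 * K / r) N0.
set S := `|L 0| + M + 1.
have S0 : 0 < S by rewrite ltr_wpDl// addr_ge0.
exists (e / 2 / S); first by rewrite divr_gt0.
move=> a x /andP[a0]; rewrite ler_pdivlMr// => aS.
have aM : a * M <= e / 2.
  by apply: le_trans aS; rewrite ler_wpM2l// /S addrAC lerDr addr_ge0.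
have aL : a * `|L 0| <= e / 2.
  by apply: le_trans aS; rewrite ler_wpM2l// /S -addrA lerDl addr_ge0.
rewrite ler_norml; apply/andP; split.
- have := hopf_sup_ub a u x 0 a0 bu; rewrite scaler0 addr0.
  have := ler_wpM2l a0 (ler_norm (L 0)); lra.
- rewrite lerBlDr; apply: hopf_sup_le => q.
  have [qr|rq] := ltP (a * `|q|) r.
    have := rP (x + a *: q) x.
    rewrite addrAC subrr add0r normrZ ger0_norm// => /(_ qr)/ltW.
    have := ler_wpM2l a0 (LM q); rewrite ler_norml.
    have : 0 <= a * (2 * K / r * `|q|) by rewrite mulr_ge0// mulr_ge0.
    rewrite mulrDr; lra.
  have := ler_wpM2l a0 (LM q); rewrite mulrDr mulrCA.
  have := ler_wpM2l N0 rq; rewrite divfK ?gt_eqF//.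
  have := uK x; have := uK (x + a *: q); rewrite !ler_norml; lra.
Qed.

End hopf_sup_theory.

(** * Backward steps shorten the regularity *)

Lemma exists_small_factor {R : realType} (A1 A2 : R) : 0 <= A1 -> 0 < A2 ->
  exists2 e, 0 < e < 1 & e * A1 < A2.
Proof.
move=> A10 A20; exists (2^-1 * Num.min 1 (A2 / (A1 + 1))).
  have m0 : 0 < Num.min 1 (A2 / (A1 + 1)).
    by rewrite lt_min ltr01 divr_gt0// ltr_wpDl.
  have m1 : Num.min 1 (A2 / (A1 + 1)) <= 1 by rewrite ge_min lexx.
  by apply/andP; split; lra.
have A11 : 0 < A1 + 1 by rewrite ltr_wpDl.
have : Num.min 1 (A2 / (A1 + 1)) <= A2 / (A1 + 1) by rewrite ge_min lexx orbT.
rewrite ler_pdivlMr//; set m := Num.min _ _ => hm.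
have m0 : 0 < m by rewrite /m lt_min ltr01 divr_gt0.
nra.
Qed.

Section hopf_inf_theory.
Context {R : realType} {d : nat} {H L : 'rV[R]_d -> R} {B : 'M[R]_d} {c C : R}.
Hypothesis HL : legendre_pair H L B c C.
Implicit Types (p q r x y z e h : 'rV[R]_d) (a b : R) (u v w : 'rV[R]_d -> R).
Local Notation V := 'rV[R]_d.
Local Notation T := (hopf_sup L).
Local Notation S := (hopf_inf L).

Let HL' := legendre_pair_opp HL.

Lemma hopf_inf_lb a u x q : 0 <= a -> BUC [set: V] u ->
  S a u x <= u (x - a *: q) + a * L q.
Proof.
move=> a0 bu; rewrite /hopf_inf lerNl.
have := hopf_sup_ub HL' a _ x (- q) a0 (BUC_opp _ _ bu).
by rewrite /= opprK scalerN; apply: le_trans; rewrite opprD.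
Qed.

Lemma hopf_inf_attained a u x : 0 <= a -> BUC [set: V] u ->
  exists q, S a u x = u (x - a *: q) + a * L q.
Proof.
move=> a0 bu; have [q qP] := hopf_sup_attained HL' a _ x a0 (BUC_opp _ _ bu).
by exists (- q); rewrite /hopf_inf qP /= scalerN opprB !opprK addrC.
Qed.

Lemma hopf_inf_leD a u v x y (e : R) : 0 <= a -> BUC [set: V] u -> BUC [set: V] v ->
  (forall h, u (x + h) <= v (y + h) + e) -> S a u x <= S a v y + e.
Proof.
move=> a0 bu bv uv; have [q ->] := hopf_inf_attained a v y a0 bv.
have := hopf_inf_lb a u x q a0 bu; have := uv (- (a *: q)); lra.
Qed.

Lemma hopf_inf0 u : S 0 u = u.
Proof. by apply/funext => x; rewrite /hopf_inf hopf_sup0 opprK. Qed.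

Lemma BUC_hopf_inf a u : 0 <= a -> BUC [set: V] u -> BUC [set: V] (S a u).
Proof.
by move=> a0 bu; apply/BUC_opp/(BUC_hopf_sup HL') => //; exact: BUC_opp.
Qed.

Lemma hopf_inf_semigroup a b u : 0 <= a -> 0 <= b -> BUC [set: V] u ->
  S a (S b u) = S (a + b) u.
Proof.
move=> a0 b0 bu; apply/funext => x; rewrite /hopf_inf.
rewrite -(hopf_sup_semigroup HL' a b _ a0 b0 (BUC_opp _ _ bu)).
by under [X in hopf_sup _ a X]eq_fun do rewrite opprK.
Qed.

Lemma hopf_sup_inf_le a u x : 0 <= a -> BUC [set: V] u -> T a (S a u) x <= u x.
Proof.
move=> a0 bu; apply: hopf_sup_le => q.
by rewrite lerBlDr; have := hopf_inf_lb a u (x + a *: q) q a0 bu; rewrite addrK.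
Qed.

Lemma hopf_inf_sup_ge a u x : 0 <= a -> BUC [set: V] u -> u x <= S a (T a u) x.
Proof.
move=> a0 bu; have bTu := BUC_hopf_sup HL a u a0 bu.
have [q ->] := hopf_inf_attained a (T a u) x a0 bTu.
by have := hopf_sup_ub HL a u (x - a *: q) q a0 bu; rewrite subrK lerBlDr.
Qed.

(** T_a and S_a form a Galois connection, so the functions fixed by T_a S_a are
    those of the range of T_a. *)
Lemma hopf_sup_inf_sup a v : 0 <= a -> BUC [set: V] v ->
  T a (S a (T a v)) = T a v.
Proof.
move=> a0 bv; have bTv := BUC_hopf_sup HL a v a0 bv.
have bSTv := BUC_hopf_inf a _ a0 bTv.
apply/funext => x; apply/eqP; rewrite eq_le hopf_sup_inf_le//=.
rewrite -[leRHS]addr0; apply: (hopf_sup_leD HL) => // h.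
by rewrite addr0; exact: hopf_inf_sup_ge.
Qed.

(** The maximizer q at z is a competitor, with velocity q - e / a, at z + e. *)
Lemma hopf_sup_touching a v z : 0 < a -> BUC [set: V] v ->
  exists q, forall e, T a v z + a * L q - a * L (q - a^-1 *: e) <= T a v (z + e).
Proof.
move=> a0 bv; have [q qP] := hopf_sup_attained HL a v z (ltW a0) bv.
exists q => e; have := hopf_sup_ub HL a v (z + e) (q - a^-1 *: e) (ltW a0) bv.
have -> : z + e + a *: (q - a^-1 *: e) = z + a *: q.
  by apply/rowP => i; rewrite !mxE; field; rewrite gt_eqF.
by rewrite qP; lra.
Qed.

Lemma mixed_diff_form_ge0 q k r : 0 < mixed_diff L q k r -> 0 <= dotv (k *m B) r.
Proof.
move=> X0; rewrite leNgt; apply/negP => b0.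
have := mixed_diff_bounds HL (q + r) k (- r).
rewrite dotvNr oppr_ge0 => /(_ (ltW b0))/andP[+ _].
have -> : mixed_diff L (q + r) k (- r) = - mixed_diff L q k r.
  rewrite /mixed_diff.
  have -> : q + r + k - r = q + k by apply/rowP => i; rewrite !mxE; ring.
  have -> : q + r - r = q by apply/rowP => i; rewrite !mxE; ring.
  by rewrite [q + r + k]addrAC; ring.
have := mixed_lower_gt0 HL; nra.
Qed.

(** The function u is touched from below, at every point, by some translate of
    - a L(- . / a), and at z by a translate of - b L(- . / b) with b < a and
    slope p there.  The translate g of - a L(- . / a) that has slope p at z then
    stays below u.  Otherwise u (z + e) < g (z + e) for some e.  Let g' be a
    touching function at the nearby point z + s e.  There g' = u >= g - O(s^2)
    by tangency, while g' <= u at z and at z + e.  Hence g' - g drops by a fixed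
    amount from z + s e to z + e.  Mixed differences of L being comparable to a
    bilinear form, g' - g also drops from z to z + s e, by at least a multiple of
    s.  But it is nonpositive at z and at least - O(s^2) at z + s e. *)
Lemma local_touching_global a b u z q : 0 < b -> b < a ->
  (forall y, exists q', forall e, u y + a * L q' - a * L (q' - a^-1 *: e) <= u (y + e)) ->
  (forall e, u z + b * L q - b * L (q - b^-1 *: e) <= u (z + e)) ->
  forall e, u z + a * L q - a * L (q - a^-1 *: e) <= u (z + e).
Proof.
move=> b0 ba ua ub e; have a0 : 0 < a by exact: lt_trans ba.
rewrite leNgt; apply/negP => hlt.
have [r rE] : exists r, r = a^-1 *: e by exists (a^-1 *: e).
rewrite -rE in hlt.
set D := u z + a * L q - a * L (q - r) - u (z + e).
have D0 : 0 < D by rewrite /D; lra.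
have [p pq] := legendre_momentum HL q.
have be0 := mixed_form_ge0 HL e.
(* the tangency error of the two translates at z + s e is at most s^2 K *)
set K := `|C| * dotv (e *m B) e / b.
have K0 : 0 <= K by rewrite /K divr_ge0 ?mulr_ge0// ltW.
have c0 := mixed_lower_gt0 HL.
(* s is so small that a drop of order s cannot be hidden in errors of order s^2 *)
have [s /andP[s0 s1] sD] := exists_small_factor (K + `|C| * K / c) D
  (addr_ge0 K0 (divr_ge0 (mulr_ge0 (normr_ge0 _) K0) (ltW c0))) D0.
have [q' q'P] := ua (z + s *: e).
have hA := q'P (- (s *: e)); rewrite addrK in hA.
have hB := q'P ((1 - s) *: e).
have zE : z + s *: e + (1 - s) *: e = z + e.
  by apply/rowP => i; rewrite !mxE; ring.
rewrite zE in hB.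
have hC := ub (s *: e).
have E1 : a^-1 *: - (s *: e) = - (s *: r) by rewrite rE scalerN scalerA mulrC -scalerA.
have E2 : a^-1 *: ((1 - s) *: e) = (1 - s) *: r by rewrite rE scalerA mulrC -scalerA.
rewrite E1 opprK in hA; rewrite E2 in hB.
have hb : b * L (q - b^-1 *: (s *: e)) <= b * L q - s * dotv p e + s * (s * K).
  have := legendre_upper HL p q (- (b^-1 *: (s *: e))) pq.
  rewrite scalerA mulNmx dotvNl !dotvNr opprK -scalemxAl dotvZl !dotvZr.
  move=> /(ler_wpM2l (ltW b0)) /le_trans; apply.
  rewrite !mulrDr mulrN -mulrA [b * (b^-1 * _)]mulrA divff ?gt_eqF// mul1r.
  rewrite lerD2l.
  have -> : b * (C * (b^-1 * s * (b^-1 * s * dotv (e *m B) e))) =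
      s * (s * (C * dotv (e *m B) e / b)) by field; rewrite gt_eqF.
  rewrite !ler_pM2l// /K ler_pM2r ?invr_gt0// ler_wpM2r//.
  exact: ler_norm.
have ha : a * L q - s * dotv p e <= a * L (q - s *: r).
  have := legendre_subgradient HL p q (q - s *: r) pq.
  rewrite addrAC subrr add0r dotvNr dotvZr rE dotvZr.
  move=> /(ler_wpM2l (ltW a0)); apply: le_trans.
  rewrite le_eqVlt; apply/orP; left; apply/eqP; field.
  by rewrite gt_eqF.
(* with this k, the variations of g' - g are mixed differences of L *)
pose k := q - s *: r - q'.
have X1E : mixed_diff L (q' - (1 - s) *: r) k ((1 - s) *: r) =
    L (q - s *: r) - L (q - r) - L q' + L (q' - (1 - s) *: r).
  rewrite /mixed_diff subrK.
  have -> : q' - (1 - s) *: r + k = q - r.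
    by apply/rowP => i; rewrite !mxE; ring.
  have -> : q - r + (1 - s) *: r = q - s *: r.
    by apply/rowP => i; rewrite !mxE; ring.
  by [].
have X2E : mixed_diff L q' k (s *: r) =
    L q - L (q - s *: r) - L (q' + s *: r) + L q'.
  by rewrite /mixed_diff /k [q' + _]addrC subrK subrK.
have X1lb : D - s * (s * K) <= a * mixed_diff L (q' - (1 - s) *: r) k ((1 - s) *: r).
  rewrite X1E /D; lra.
have X2ub : a * mixed_diff L q' k (s *: r) <= s * (s * K).
  rewrite X2E; lra.
have sK : s * (s * K) <= s * K by rewrite ler_pM2l ?ler_piMl ?(ltW s1).
have CK0 : 0 <= `|C| * K / c by apply: divr_ge0; [exact: mulr_ge0|exact: ltW].
have X1gt : 0 < mixed_diff L (q' - (1 - s) *: r) k ((1 - s) *: r).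
  rewrite -(pmulr_rgt0 _ a0); apply: lt_le_trans X1lb.
  rewrite mulrDr in sD; have : 0 <= s * (`|C| * K / c) by rewrite mulr_ge0// ltW.
  lra.
have s10 : 0 < 1 - s by lra.
have := mixed_diff_form_ge0 _ _ _ X1gt; rewrite dotvZr pmulr_rge0// => bb0.
have /andP[_ X1ub] := mixed_diff_bounds HL (q' - (1 - s) *: r) k ((1 - s) *: r)
  (mixed_diff_form_ge0 _ _ _ X1gt).
have bs0 : 0 <= dotv (k *m B) (s *: r) by rewrite dotvZr mulr_ge0// ltW.
have /andP[X2lb _] := mixed_diff_bounds HL q' k (s *: r) bs0.
move: X1ub X2lb; rewrite !dotvZr; set bt := dotv (k *m B) r in bb0 *.
move=> X1ub X2lb.
have abt : a * bt <= s * K / c.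
  rewrite ler_pdivlMr//; rewrite -(ler_pM2l s0).
  apply: le_trans X2ub; apply: le_trans (ler_wpM2l (ltW a0) X2lb).
  rewrite le_eqVlt; apply/orP; left; apply/eqP. ring.
have : D <= s * K + `|C| * (s * K / c).
  have h1 : a * (C * ((1 - s) * bt)) <= `|C| * (a * bt).
    apply: (@le_trans _ _ (`|C| * ((1 - s) * (a * bt)))).
      rewrite [leLHS](_ : _ = C * ((1 - s) * (a * bt))); last ring.
      apply: ler_wpM2r (ler_norm C).
      by rewrite !mulr_ge0// ltW.
    rewrite ler_wpM2l// ler_piMl ?mulr_ge0// ?(ltW a0)//.
    by lra.
  have h2 := ler_wpM2l (ltW a0) X1ub.
  have h3 := ler_wpM2l (normr_ge0 C) abt.
  lra.
rewrite [X in D <= X](_ : _ = s * (K + `|C| * K / c)); last ring.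
by lra.
Qed.

(** A backward step of length b < a costs b units of regularity.  If z = x - b q
    is optimal for S_b at x, then u = T_a v is touched at z from below by a
    translate of - b L(- . / b), hence, by [local_touching_global], by the
    translate of - a L(- . / a) with the same slope.  The latter says that z is
    also optimal for S_a at z + a q = x + (a - b) q, so that q is a velocity with
    which T_(a-b) (S_a u) reaches the value S_b u at x. *)
Lemma hopf_inf_of_sup a b v : 0 <= b -> b < a -> BUC [set: V] v ->
  S b (T a v) = T (a - b) (S a (T a v)).
Proof.
rewrite le_eqVlt => /predU1P[<- a0 bv|b0 ba bv].
  by rewrite subr0 hopf_inf0 hopf_sup_inf_sup// ltW.
have a0 : 0 < a by exact: lt_trans ba.
have ab0 : 0 <= a - b by rewrite subr_ge0 ltW.
set u := T a v; have bu : BUC [set: V] u := BUC_hopf_sup HL a v (ltW a0) bv.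
have bSa := BUC_hopf_inf a u (ltW a0) bu.
have bSb := BUC_hopf_inf b u (ltW b0) bu.
apply/funext => x; apply/eqP; rewrite eq_le; apply/andP; split; last first.
  rewrite -[a in S a u](subrK b) -(hopf_inf_semigroup (a - b) b u ab0 (ltW b0) bu).
  exact: hopf_sup_inf_le.
have [q Sx] := hopf_inf_attained b u x (ltW b0) bu.
set z := x - b *: q in Sx.
apply: le_trans (hopf_sup_ub HL (a - b) (S a u) x q ab0 bSa).
have [q' ->] := hopf_inf_attained a u (x + (a - b) *: q) (ltW a0) bu.
have touch_b e : u z + b * L q - b * L (q - b^-1 *: e) <= u (z + e).
  have := hopf_inf_lb b u x (q - b^-1 *: e) (ltW b0) bu.
  have -> : x - b *: (q - b^-1 *: e) = z + e.
    by apply/rowP => i; rewrite !mxE; field; rewrite gt_eqF.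
  by rewrite Sx; lra.
have := local_touching_global a b u z q b0 ba
  (fun y => hopf_sup_touching a v y a0 bv) touch_b (a *: (q - q')).
have -> : q - a^-1 *: (a *: (q - q')) = q'.
  by apply/rowP => i; rewrite !mxE; field; rewrite gt_eqF.
have -> : x + (a - b) *: q - a *: q' = z + a *: (q - q').
  by apply/rowP => i; rewrite !mxE; ring.
by rewrite Sx; lra.
Qed.

End hopf_inf_theory.

(** * Differential calculus of C^1 and C^2 functions *)

Section Ck_directional.
Context {R : realType} {V : normedModType R}.
Implicit Types (f : V -> R) (x v w : V) (a h s : R).

Lemma is_derive_unique f x v (l l' : R) :
  is_derive x v (f : V -> R^o) l -> is_derive x v (f : V -> R^o) l' -> l = l'.
Proof. by move=> [_ <-] [_ <-]. Qed.

Lemma is_derive_dirZ f x v (l a : R) :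
  is_derive x v (f : V -> R^o) l -> is_derive x (a *: v) (f : V -> R^o) (a * l).
Proof.
move=> /is_derive_epsP df; apply/is_derive_epsP => e e0.
have a1 : 0 < `|a| + 1 by rewrite ltr_wpDl.
have [r r0 rP] := df (e / (`|a| + 1)) (divr_gt0 e0 a1).
exists (r / (`|a| + 1)); first exact: divr_gt0.
move=> h; rewrite ltr_pdivlMr// => hr.
have := rP (h * a); rewrite normrM -scalerA -mulrA => H.
apply: le_trans (H _) _.
  by apply: le_lt_trans hr; rewrite ler_wpM2l// lerDl.
rewrite mulrAC ler_pdivrMr// -[leRHS]mulrA ler_wpM2l ?(ltW e0)//.
by rewrite ler_wpM2l// lerDl.
Qed.

Lemma Ck1_is_derive f x v : Ck 1 f -> is_derive x v (f : V -> R^o) ('D_v f x).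
Proof. by move=> [_ /(_ v)[df _]]; split. Qed.

Lemma Ck1_derive_continuous f v : Ck 1 f -> continuous ('D_v (f : V -> R^o)).
Proof. by move=> [_ /(_ v)[_ []]]. Qed.

Lemma Ck1_derive_scale f x v a : Ck 1 f ->
  'D_(a *: v) (f : V -> R^o) x = a * 'D_v (f : V -> R^o) x.
Proof.
move=> cf; apply: (is_derive_unique f x (a *: v)); first exact: Ck1_is_derive.
exact/is_derive_dirZ/Ck1_is_derive.
Qed.

Lemma Ck1_line f x v s : Ck 1 f ->
  is_derive s 1 (fun s : R => f (x + s *: v) : R^o) ('D_v (f : V -> R^o) (x + s *: v)).
Proof.
move=> cf; apply/is_derive_epsP => e e0.
have /is_derive_epsP/(_ e e0)[r r0 rP] := Ck1_is_derive f (x + s *: v) v cf.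
by exists r => // h hr; rewrite [h *: 1]mulr1 scalerDl addrA; exact: rP.
Qed.

Lemma is_derive_continuous (g : R -> R) (s l : R) :
  is_derive s 1 (g : R -> R^o) l -> {for s, continuous g}.
Proof.
by move=> [dg _]; apply: differentiable_continuous; exact/derivable1_diffP.
Qed.

Lemma Ck1_mean_value f x v : Ck 1 f ->
  exists2 s, 0 <= s <= 1 & f (x + v) - f x = 'D_v (f : V -> R^o) (x + s *: v).
Proof.
move=> cf.
have [s|s|s] := @MVT_segment R (fun s => f (x + s *: v))
   (fun s => 'D_v (f : V -> R^o) (x + s *: v)) 0 1 ler01.
- by move=> _; exact: Ck1_line.
- by apply: continuous_subspaceT => z; apply: is_derive_continuous; exact: Ck1_line.
- by rewrite in_itv /= => s01; rewrite scale1r scale0r addr0 subr0 mulr1; exists s.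
Qed.

(** Move along h v and then along h w: by the mean value theorem the second
    increment is h times a value of D_w f near x, and D_w f is continuous. *)
Lemma Ck1_derive_add f x v w : Ck 1 f ->
  'D_(v + w) (f : V -> R^o) x = 'D_v (f : V -> R^o) x + 'D_w (f : V -> R^o) x.
Proof.
move=> cf; apply: (is_derive_unique f x (v + w)); first exact: Ck1_is_derive.
apply/is_derive_epsP => e e0; have e20 : 0 < e / 2 by rewrite divr_gt0.
have /is_derive_epsP/(_ _ e20)[r r0 rP] := Ck1_is_derive f x v cf.
have /continuous_epsP/(_ _ e20)[r' r'0 r'P] := Ck1_derive_continuous f w cf x.
set N := `|v| + `|w| + 1.
have N0 : 0 < N by rewrite ltr_wpDl// addr_ge0.
exists (Num.min r (r' / N)); first by rewrite lt_min r0 divr_gt0.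
move=> h; rewrite lt_min => /andP[hr hr'].
have [s /andP[s0 s1] sE] := Ck1_mean_value f (x + h *: v) (h *: w) cf.
rewrite Ck1_derive_scale// in sE.
have near_x : `|x + h *: v + s *: (h *: w) - x| < r'.
  rewrite addrAC [x + _]addrC addrK.
  apply: (le_lt_trans (ler_normD _ _)); rewrite !normrZ (ger0_norm s0).
  rewrite ltr_pdivlMr// in hr'; apply: le_lt_trans hr'.
  rewrite /N !mulrDr -addrA lerD2l mulr1.
  rewrite (@le_trans _ _ (`|h| * `|w|))// ?lerDl//.
  by rewrite ler_piMl// mulr_ge0.
have h1 := rP h hr; have := r'P _ near_x.
rewrite scalerDr addrA.
move: sE; set z := 'D_w _ (_ + _); set Dw := 'D_w _ x; set Dv := 'D_v _ x in h1 *.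
move=> sE h2.
have -> : f (x + h *: v + h *: w) - f x - h * (Dv + Dw) =
    (f (x + h *: v) - f x - h * Dv) + h * (z - Dw).
  by rewrite -[f (x + h *: v + h *: w)](subrK (f (x + h *: v))) sE; ring.
apply: le_trans (ler_normD _ _) _; rewrite normrM.
have := ler_wpM2l (normr_ge0 h) h2; lra.
Qed.

Lemma Ck1_derive_lincomb {I : finType} f x (a : I -> R) (v : I -> V) : Ck 1 f ->
  'D_(\sum_i a i *: v i) (f : V -> R^o) x = \sum_i a i * 'D_(v i) (f : V -> R^o) x.
Proof.
move=> cf.
elim/big_ind2 : _ => [|y l z m <- <-|i _].
- by rewrite -(scale0r 0) Ck1_derive_scale// mul0r.
- exact: Ck1_derive_add.
- exact: Ck1_derive_scale.
Qed.

End Ck_directional.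

Lemma mean_value_continuous {R : realType} (f g : R -> R) (a b : R) : a <= b ->
  (forall s : R, is_derive s 1 (f : R -> R^o) (g s)) ->
  exists2 s, a <= s <= b & f b - f a = g s * (b - a).
Proof.
move=> ab df; have [|s] := MVT_segment ab (fun s _ => df s).
  by apply: continuous_subspaceT => s; exact: is_derive_continuous (df s).
by rewrite in_itv /= => sab ->; exists s.
Qed.

(** The two signs of s bound the derivative from both sides. *)
Lemma first_order_touching {R : realType} (f : R -> R) (l m M : R) :
  is_derive (0 : R) 1 (f : R -> R^o) l ->
  (forall s, s * m - M * s ^+ 2 <= f s - f 0) -> l = m.
Proof.
move=> /is_derive_epsP df fm; apply/eqP; rewrite -subr_eq0 -normr_le0.
apply/ler_addgt0Pr => e e0; rewrite add0r.
have e20 : 0 < e / 2 by rewrite divr_gt0.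
have [r r0 rP] := df _ e20.
have M1 : 0 < `|M| + 1 by rewrite ltr_wpDl.
set s := Num.min r (e / (`|M| + 1)) / 2.
have m0 : 0 < Num.min r (e / (`|M| + 1)) by rewrite lt_min r0 divr_gt0.
have s0 : 0 < s by rewrite divr_gt0.
have : s < Num.min r (e / (`|M| + 1)) by rewrite /s ltr_pdivrMr// mulr_natr mulr2n ltrDl.
have s2 : 2 * s <= e / (`|M| + 1) by rewrite /s mulrC divfK// ge_min lexx orbT.
rewrite lt_min => /andP[sr _].
have Ms : `|M| * s <= e / 2.
  by move: s2; rewrite ler_pdivlMr//; lra.
have Ms1 : M * s <= e / 2.
  by apply: le_trans Ms; rewrite ler_pM2r// ler_norm.
have h1 := rP s; rewrite (gtr0_norm s0) [s *: 1]mulr1 add0r in h1.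
have {}h1 := h1 sr.
have h2 := rP (- s); rewrite normrN (gtr0_norm s0) [- s *: 1]mulr1 add0r in h2.
have {}h2 := h2 sr.
have h3 := fm s; have h4 := fm (- s); rewrite sqrrN in h4.
rewrite !ler_norml in h1 h2; move: h1 h2 => /andP[h1 h1'] /andP[h2 h2'].
rewrite -(ler_pM2l s0).
have -> : s * `|l - m| = `|s * (l - m)| by rewrite normrM gtr0_norm.
rewrite ler_norml.
have := ler_wpM2l (ltW s0) Ms1; rewrite expr2 in h3 h4.
by move=> h5; apply/andP; split; lra.
Qed.

(** Subtract from f the polynomial s g(0) + (l2 + e) s^2 / 2.  For small
    positive s the derivative of the difference is nonpositive, so f lies below
    this polynomial, and the lower bound on f forces - M <= l2 + e. *)
Lemma second_order_touching {R : realType} (f g : R -> R) (l2 M r : R) : 0 < r ->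
  (forall s : R, is_derive s 1 (f : R -> R^o) (g s)) ->
  is_derive (0 : R) 1 (g : R -> R^o) l2 ->
  (forall s, `|s| < r -> s * g 0 - M / 2 * s ^+ 2 <= f s - f 0) -> - M <= l2.
Proof.
move=> r0 df /is_derive_epsP dg fM; apply/ler_addgt0Pr => e e0.
have [r1 r10 r1P] := dg e e0.
set s := Num.min r r1 / 2.
have m0 : 0 < Num.min r r1 by rewrite lt_min r0.
have s0 : 0 < s by rewrite divr_gt0.
have : s < Num.min r r1 by rewrite /s ltr_pdivrMr// mulr_natr mulr2n ltrDl.
rewrite lt_min => /andP[sr sr1].
pose h (s : R) : R := f s - s * g 0 - (l2 + e) / 2 * s ^+ 2.
have dh (t : R) : is_derive t 1 (h : R -> R^o) (g t - g 0 - (l2 + e) * t).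
  have := df t; move=> /is_derive_epsP dft; apply/is_derive_epsP => e' e'0.
  have e'20 : 0 < e' / 2 by rewrite divr_gt0.
  have [r2 r20 r2P] := dft _ e'20.
  have N0 : 0 < `|(l2 + e) / 2| + 1 by rewrite ltr_wpDl.
  exists (Num.min r2 (e' / 2 / (`|(l2 + e) / 2| + 1))); first by rewrite lt_min r20 divr_gt0.
  move=> k; rewrite lt_min ltr_pdivlMr// => /andP[/r2P k2 kN].
  rewrite [k *: 1]mulr1 in k2 *.
  have -> : h (t + k) - h t - k * (g t - g 0 - (l2 + e) * t) =
     (f (t + k) - f t - k * g t) - (l2 + e) / 2 * k * k by rewrite /h; field.
  apply: le_trans (ler_normB _ _) _; rewrite !normrM in kN *.
  have := ler_wpM2r (normr_ge0 k) (ltW kN); have := normr_ge0 k; nra.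
have [t /andP[t0 ts] hE] := mean_value_continuous _ _ 0 s (ltW s0) dh.
have := r1P t; rewrite ger0_norm// [t *: 1]mulr1 add0r => /(_ (le_lt_trans ts sr1)).
rewrite ler_norml => /andP[_ h1].
have hs : h s - h 0 <= 0.
  rewrite hE subr0; apply: mulr_le0_ge0 (ltW s0); lra.
have := fM s; rewrite gtr0_norm// => /(_ sr).
rewrite /h expr0n /= mulr0 subr0 mul0r subr0 in hs.
have s20 : 0 < s ^+ 2 by rewrite exprn_gt0.
move=> h2; rewrite -(ler_pM2r s20); lra.
Qed.

Section Ck_row.
Context {R : realType} {d : nat}.
Implicit Types (f : 'rV[R]_d -> R) (x v : 'rV[R]_d).

Lemma derive_grad f x v : Ck 1 f -> 'D_v (f : _ -> R^o) x = dotv v (grad f x).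
Proof.
move=> cf; rewrite {1}(row_sum_delta v) Ck1_derive_lincomb// dotvE.
by apply: eq_bigr => i _; rewrite mxE.
Qed.

Lemma Ck2_Ck1 f : Ck 2 f -> Ck 1 f.
Proof. by case=> cf df; split=> // w; have [dw [cw _]] := df w; split. Qed.

Lemma Ck2_derive f v : Ck 2 f -> Ck 1 ('D_v (f : _ -> R^o)).
Proof. by case=> _ /(_ v)[]. Qed.

Lemma derive2_hess f x v : Ck 2 f ->
  'D_v ('D_v (f : _ -> R^o) : _ -> R^o) x = qform (hess f x) v.
Proof.
move=> c2; have c1 := Ck2_Ck1 f c2.
have dE : 'D_v (f : _ -> R^o) =
    \sum_(i < d) (v 0 i *: 'D_(delta_mx 0 i) (f : _ -> R^o)).
  apply/funext => y; rewrite {1}(row_sum_delta v) Ck1_derive_lincomb//.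
  by rewrite fct_sumE.
have cD w : Ck 1 ('D_w (f : _ -> R^o)) := Ck2_derive f w c2.
have : is_derive x v ('D_v (f : _ -> R^o) : _ -> R^o)
    (\sum_(i < d) v 0 i *: 'D_v ('D_(delta_mx 0 i) (f : _ -> R^o) : _ -> R^o) x).
  rewrite [X in is_derive _ _ X _]dE; apply: is_derive_sum => i.
  by apply: is_deriveZ; exact: Ck1_is_derive.
move=> [_ ->]; rewrite /qform mxE; apply: eq_bigr => j _.
rewrite derive_grad// dotvE !mxE mulrC; congr (_ * _).
by apply: eq_bigr => i _; rewrite !mxE.
Qed.

End Ck_row.

Section expansion.
Context {R : realType} {d : nat}.
Local Notation VR := ('rV[R]_d * R)%type.

Lemma is_derive_slice_space (phi : VR -> R) (x0 v : 'rV[R]_d) (t0 l : R) :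
  is_derive (x0, t0) (v, 0 : R) (phi : VR -> R^o) l ->
  is_derive x0 v (fun x => phi (x, t0) : R^o) l.
Proof.
move=> /is_derive_epsP dphi; apply/is_derive_epsP => e /dphi[r r0 rP].
exists r => // h /rP; suff -> : (x0, t0) + h *: (v, 0) = (x0 + h *: v, t0) by [].
by congr pair; rewrite /= scaler0 addr0.
Qed.

Lemma is_derive_slice_time (phi : VR -> R) (x0 : 'rV[R]_d) (t0 l : R) :
  is_derive (x0, t0) (0 : 'rV[R]_d, 1 : R) (phi : VR -> R^o) l ->
  is_derive t0 1 (fun t => phi (x0, t) : R^o) l.
Proof.
move=> /is_derive_epsP dphi; apply/is_derive_epsP => e /dphi[r r0 rP].
exists r => // h /rP.
suff -> : (x0, t0) + h *: (0 : 'rV[R]_d, 1 : R) = (x0, t0 + h *: (1 : R)) by [].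
by congr pair; rewrite /= scaler0 addr0.
Qed.

(** Continuous partial derivatives give differentiability: by the mean value
    theorem the error is a combination of the oscillations, near (x0, t0), of the
    d + 1 partial derivatives. *)
Lemma space_time_expansion (phi : VR -> R) (x0 : 'rV[R]_d) (t0 e : R) :
  Ck 1 phi -> 0 < e ->
  exists2 r, 0 < r & forall y s, `|y - x0| < r -> `|s - t0| < r ->
    `|phi (y, s) - phi (x0, t0) - dotv (grad (fun x => phi (x, t0)) x0) (y - x0)
      - derive1 (fun t => phi (x0, t)) t0 * (s - t0)| <= e * (`|y - x0| + `|s - t0|).
Proof.
move=> cphi e0.
pose D v z := 'D_v (phi : VR -> R^o) z.
pose E (i : 'I_d) : VR := (delta_mx 0 i, 0).
pose F : VR := (0, 1).
have gradE : grad (fun x => phi (x, t0)) x0 = \row_i D (E i) (x0, t0).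
  apply/rowP => i; rewrite !mxE.
  have /is_derive_slice_space[_ ->//] := Ck1_is_derive phi (x0, t0) (E i) cphi.
have dtE : derive1 (fun t => phi (x0, t)) t0 = D F (x0, t0).
  rewrite derive1E.
  have /is_derive_slice_time[_ ->//] := Ck1_is_derive phi (x0, t0) F cphi.
have DE y s z : D (y - x0, s - t0) z =
    dotv (\row_i D (E i) z) (y - x0) + D F z * (s - t0).
  have -> : (y - x0, s - t0) =
      \sum_i ((y - x0) 0 i *: E i) + (s - t0) *: F :> VR.
    rewrite [RHS]surjective_pairing /= !raddf_sum /= ?scaler0 addr0.
    congr pair; first by rewrite {1}[y - x0]row_sum_delta; apply: eq_bigr.
    rewrite big1 ?add0r; last by move=> i _; rewrite scaler0.
    by rewrite [RHS]mulr1.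
  rewrite /D Ck1_derive_add// Ck1_derive_lincomb// Ck1_derive_scale//.
  congr (_ + _); last by rewrite mulrC.
  by rewrite dotvE; apply: eq_bigr => i _; rewrite [in RHS]mxE mulrC.
set e' := e / (d%:R * 1 + 1).
have N0 : 0 < d%:R * 1 + 1 :> R by rewrite ltr_wpDl.
have e'0 : 0 < e' by rewrite divr_gt0.
have near_i i : \forall z \near (x0, t0), `|D (E i) z - D (E i) (x0, t0)| <= e'.
  have /continuous_epsP/(_ e' e'0)[r r0 rP] := Ck1_derive_continuous phi (E i) cphi (x0, t0).
  by apply/nbhs_ballP; exists r => // z; rewrite -ball_normE /= distrC; exact: rP.
have /nbhs_ballP[r1 /= r10 r1P] : nbhs (x0, t0)
    [set z | forall i, `|D (E i) z - D (E i) (x0, t0)| <= e'].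
  exact: filter_forall near_i.
have /continuous_epsP/(_ e' e'0)[r2 r20 r2P] := Ck1_derive_continuous phi F cphi (x0, t0).
exists (Num.min r1 r2); first by rewrite lt_min r10.
move=> y s; rewrite !lt_min => /andP[yr1 yr2] /andP[sr1 sr2].
have [k /andP[k0 k1] kE] := Ck1_mean_value phi (x0, t0) (y - x0, s - t0) cphi.
have -> : (y, s) = (x0, t0) + (y - x0, s - t0).
  by congr pair; rewrite addrC subrK.
rewrite kE -[X in X - _ - _]/(D _ _) gradE dtE DE.
set z := _ + k *: _.
have zr (r : R) : `|y - x0| < r -> `|s - t0| < r -> `|z - (x0, t0)| < r.
  move=> yr sr; rewrite /z addrAC subrr add0r normrZ ger0_norm//.
  apply: (@le_lt_trans _ _ `|(y - x0, s - t0) : VR|).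
    by rewrite ler_piMl.
  by rewrite prod_normE /= gt_max yr.
have i1 i : `|D (E i) z - D (E i) (x0, t0)| <= e'.
  by apply: r1P; rewrite -ball_normE /= distrC; exact: zr.
have i2 := r2P z (zr _ yr2 sr2).
have -> : dotv (\row_i D (E i) z) (y - x0) + D F z * (s - t0)
    - dotv (\row_i D (E i) (x0, t0)) (y - x0) - D F (x0, t0) * (s - t0) =
    dotv (\row_i (D (E i) z - D (E i) (x0, t0))) (y - x0)
    + (D F z - D F (x0, t0)) * (s - t0).
  rewrite [X in _ = X + _](_ : _ = dotv (\row_i D (E i) z) (y - x0)
     - dotv (\row_i D (E i) (x0, t0)) (y - x0)); first by ring.
  by rewrite -dotvNl -dotvDl; congr dotv; apply/rowP => i; rewrite !mxE.
apply: le_trans (ler_normD _ _) _; rewrite normrM mulrDr.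
have e'e : (d%:R * 1 + 1) * e' = e by rewrite /e' mulrC divfK// gt_eqF.
apply: lerD.
- apply: le_trans (normr_dotv _ _) _; apply: ler_wpM2r => //.
  rewrite -e'e mulr1 mulrDl mul1r.
  apply: (@le_trans _ _ (d%:R * e')); last by rewrite lerDl ltW.
  apply: ler_wpM2l; first exact: ler0n.
  by apply: normr_row_le => [|i]; [exact: ltW|rewrite mxE].
- apply: ler_wpM2r => //; apply: le_trans i2 _.
  by rewrite -e'e mulrDl mul1r lerDr mulr_ge0 ?mulr1// ltW.
Qed.

End expansion.

(** * Viscosity inequalities for the Hopf-Lax formula *)

Section past_viscosity.
Context {R : realType} {d : nat}.
Local Notation V := 'rV[R]_d.
Local Notation VR := ('rV[R]_d * R)%type.

(** The test function is compared with u at times up to t0 only.  This is more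
    than the usual definition asks for, and it depends on u only through its
    past, so that it is inherited by any continuation of u after t0. *)
Definition past_subsolution_at (H : V -> R) (dg : R) (u : VR -> R) (t0 : R) : Prop :=
  forall phi : VR -> R, Ck 1 phi -> forall x0 : V,
    (\forall z \near (x0, t0), z.2 <= t0 -> u z - phi z <= u (x0, t0) - phi (x0, t0)) ->
    derive1 (fun t => phi (x0, t)) t0 <= H (grad (fun x => phi (x, t0)) x0) * dg.

Definition past_supersolution_at (H : V -> R) (dg : R) (u : VR -> R) (t0 : R) : Prop :=
  forall phi : VR -> R, Ck 1 phi -> forall x0 : V,
    (\forall z \near (x0, t0), z.2 <= t0 -> u (x0, t0) - phi (x0, t0) <= u z - phi z) ->
    H (grad (fun x => phi (x, t0)) x0) * dg <= derive1 (fun t => phi (x0, t)) t0.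

Lemma Ck_opp {W : normedModType R} k (f : W -> R) : Ck k f -> Ck k (fun x => - f x).
Proof.
elim: k f => [|k IH] f /= [cf df]; split; do ?[by move=> x; apply: cvgN; exact: cf].
  by [].
move=> v; have [dv cv] := df v.
have dN x : is_derive x v ((fun y => - f y) : W -> R^o) (- 'D_v (f : W -> R^o) x).
  by apply: (is_deriveN (f := (f : W -> R^o))).
split; first by move=> x; have [] := dN x.
rewrite (_ : 'D_v _ = fun x => - 'D_v (f : W -> R^o) x); first exact: IH.
by apply/funext => x; have [_ ->] := dN x.
Qed.

Lemma grad_opp_slice (phi : VR -> R) x0 t0 : Ck 1 phi ->
  grad (fun x => - phi (x, t0)) x0 = - grad (fun x => phi (x, t0)) x0.
Proof.
move=> cphi; apply/rowP => i; rewrite !mxE.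
have d1 := is_derive_slice_space _ _ _ _ _ (Ck1_is_derive phi (x0, t0) (basis_vec R i, 0) cphi).
have [_ ->] := is_deriveN (f := (fun x => phi (x, t0) : R^o)) d1.
by have [_ ->] := d1.
Qed.

Lemma derive1_opp_slice (phi : VR -> R) x0 t0 : Ck 1 phi ->
  derive1 (fun t => - phi (x0, t)) t0 = - derive1 (fun t => phi (x0, t)) t0.
Proof.
move=> cphi; rewrite !derive1E.
have d1 := is_derive_slice_time _ _ _ _ (Ck1_is_derive phi (x0, t0) (0, 1) cphi).
have [_ ->] := is_deriveN (f := (fun t => phi (x0, t) : R^o)) d1.
by have [_ ->] := d1.
Qed.

Lemma past_subsolution_opp H dg u t0 :
  past_supersolution_at (H \o -%R) (- dg) (fun z => - u z) t0 ->
  past_subsolution_at H dg u t0.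
Proof.
move=> super phi cphi x0 max0.
have := super _ (Ck_opp 1 _ cphi) x0.
rewrite grad_opp_slice// derive1_opp_slice//= [- - grad _ _]opprK mulrN lerN2; apply.
apply: filterS max0 => z zP /zP; lra.
Qed.

Lemma past_supersolution_opp H dg u t0 :
  past_subsolution_at (H \o -%R) (- dg) (fun z => - u z) t0 ->
  past_supersolution_at H dg u t0.
Proof.
move=> sub phi cphi x0 min0.
have := sub _ (Ck_opp 1 _ cphi) x0.
rewrite grad_opp_slice// derive1_opp_slice//= [- - grad _ _]opprK mulrN lerN2; apply.
apply: filterS min0 => z zP /zP; lra.
Qed.

Lemma near_past_ball (P : VR -> Prop) (x0 : V) (t0 : R) :
  (\forall z \near (x0, t0), z.2 <= t0 -> P z) ->
  exists2 r : R, 0 < r & forall (y : V) (k : R), `|y - x0| < r -> 0 <= k < r -> P (y, t0 - k).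
Proof.
move=> /nbhs_ballP[r /= r0 rP]; exists r => // y k yr /andP[k0 kr].
apply: rP; last by rewrite /= gerBl.
rewrite -ball_normE /= prod_normE /= gt_max distrC yr /=.
by rewrite subKr ger0_norm.
Qed.

Lemma is_derive_past (g : R -> R) (t0 dg e : R) :
  is_derive t0 1 (g : R -> R^o) dg -> 0 < e ->
  exists2 r, 0 < r & forall k, 0 < k < r ->
    (dg - e) * k <= g t0 - g (t0 - k) <= (dg + e) * k.
Proof.
move=> /is_derive_epsP dgP /dgP[r r0 rP]; exists r => // k /andP[k0 kr].
have := rP (- k); rewrite normrN ger0_norm ?(ltW k0)// => /(_ kr).
by rewrite [- k *: 1]mulr1 ler_norml => /andP[h1 h2]; apply/andP; split; lra.
Qed.

Lemma increment_mul_close (tau dg k e h : R) : (dg - e) * k <= tau <= (dg + e) * k ->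
  `|tau * h - dg * k * h| <= k * e * `|h|.
Proof.
move=> /andP[h1 h2]; rewrite -mulrBl normrM ler_wpM2r// ler_norml.
by apply/andP; split; lra.
Qed.

Section hopf_sup_piece.
Context {H L : V -> R} {B : 'M[R]_d} {c C : R}.
Hypothesis HL : legendre_pair H L B c C.
Context (g : R -> R) (u : VR -> R) (T0 t0 dg K : R).
Hypothesis T0t0 : T0 < t0.
Hypothesis g_derive : is_derive t0 1 (g : R -> R^o) dg.
Hypothesis g_incr : forall s, T0 <= s < t0 -> 0 <= g t0 - g s.
Hypothesis u_bounded : forall x s, T0 <= s <= t0 -> `|u (x, s)| <= K.
Hypothesis u_BUC : forall s, T0 <= s < t0 -> BUC [set: V] (fun x => u (x, s)).
Hypothesis u_hopf : forall s x, T0 <= s < t0 ->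
  u (x, t0) = hopf_sup L (g t0 - g s) (fun y => u (y, s)) x.

(** For p = D phi (x0, t0), the velocity q dual to p is a competitor in the
    formula between the times t0 - k and t0.  Divide by k and let it tend to 0. *)
Lemma hopf_sup_supersolution : past_supersolution_at H dg u t0.
Proof.
move=> phi cphi x0 /near_past_ball[r0 r00 min0].
set p := grad _ _; set pt := derive1 _ _.
have [q pq] := legendre_velocity HL p.
apply/ler_addgt0Pr => e e0.
set N := 1 + `|H p| + (`|dg| + 1) * `|q|.
have N0 : 0 < N by rewrite ltr_pwDl ?mulr_ge0 ?addr_ge0// addr_ge0.
set e' := Num.min 1 (e / N).
have e'0 : 0 < e' by rewrite lt_min ltr01 divr_gt0.
have e'1 : e' <= 1 by rewrite ge_min lexx.
have e'N : e' * N <= e by rewrite -ler_pdivlMr// ge_min lexx orbT.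
have [r1 r10 expand] := space_time_expansion phi x0 t0 e' cphi e'0.
have [r2 r20 gP] := is_derive_past g t0 dg e' g_derive e'0.
set r3 := Num.min r0 r1 / ((`|dg| + 1) * `|q| + 1).
have Q0 : 0 < (`|dg| + 1) * `|q| + 1 by rewrite ltr_wpDl// mulr_ge0// addr_ge0.
have r30 : 0 < r3 by rewrite divr_gt0// lt_min r00.
set k := Num.min (Num.min r0 r1) (Num.min (Num.min r2 r3) (t0 - T0)) / 2.
have m0 : 0 < Num.min (Num.min r0 r1) (Num.min (Num.min r2 r3) (t0 - T0)).
  by rewrite !lt_min r00 r10 r20 r30 subr_gt0.
have k0 : 0 < k by rewrite divr_gt0.
have : k < Num.min (Num.min r0 r1) (Num.min (Num.min r2 r3) (t0 - T0)).
  by rewrite /k ltr_pdivrMr// mulr_natr mulr2n ltrDl.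
rewrite !lt_min => /andP[/andP[kr0 kr1] /andP[/andP[kr2 kr3] kT]].
have sT : T0 <= t0 - k < t0.
  by rewrite lerBrDr -lerBrDl (ltW kT) gtrBl.
have /andP[tau1 tau2] := gP k (ltac:(by rewrite k0)).
have tau0 := g_incr _ sT; set tau := g t0 - _ in tau0 tau1 tau2.
have dg1 := ler_norm dg.
have tauk : tau <= (`|dg| + 1) * k by apply: le_trans tau2 _; rewrite ler_pM2r//; lra.
have tauq : `|tau *: q| < Num.min r0 r1.
  rewrite normrZ ger0_norm//; move: kr3; rewrite /r3 ltr_pdivlMr//.
  apply: le_lt_trans; rewrite mulrDr mulr1.
  have := ler_wpM2r (normr_ge0 q) tauk; lra.
move: (tauq); rewrite lt_min => /andP[tauq0 tauq1].
have yx : x0 + tau *: q - x0 = tau *: q by rewrite addrAC subrr add0r.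
have h1 := min0 (x0 + tau *: q) k; rewrite yx in h1.
have {}h1 := h1 tauq0 (ltac:(by rewrite ltW)).
have h2 := hopf_sup_ub HL tau _ x0 q tau0 (u_BUC _ sT); rewrite -u_hopf// in h2.
have h3 := expand (x0 + tau *: q) (t0 - k); rewrite yx in h3.
have tkk : t0 - k - t0 = - k by rewrite addrAC subrr add0r.
rewrite tkk normrN (ger0_norm (ltW k0)) in h3.
have {h3} := h3 tauq1 kr1.
rewrite -/p -/pt dotvZr normrZ (ger0_norm tau0) ler_norml => /andP[h3 _].
have h4 : tau * H p <= k * pt + k * e' + e' * (tau * `|q|).
  have -> : tau * H p = tau * dotv p q - tau * L q by rewrite pq; ring.
  lra.
have h5 : e' * (tau * `|q|) <= e' * ((`|dg| + 1) * k * `|q|).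
  by rewrite ler_pM2l// ler_wpM2r.
have h6 : dg * k * H p - k * e' * `|H p| <= tau * H p.
  have := increment_mul_close tau dg k e' (H p).
  by rewrite tau1 tau2 ler_norml lerBrDl addrC => /(_ isT)/andP[].
rewrite -(ler_pM2l k0).
have := ler_wpM2l (ltW k0) e'N; rewrite /N; lra.
Qed.

(** An optimal velocity q between the times t0 - k and t0 gives
    k phi_t <= tau (p . q - L q + e' |q|) + o(k), where tau is the increment of
    g.  The starting point tends to x0, although q is only bounded a posteriori,
    because L is superlinear; the term e' |q| is absorbed by [fenchel_ball] at
    the price of replacing H p by the maximum of H near p. *)
Lemma hopf_sup_subsolution : past_subsolution_at H dg u t0.
Proof.
move=> phi cphi x0 /near_past_ball[r0 r00 max0].
set p := grad _ _; set pt := derive1 _ _.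
have T0t : T0 <= t0 <= t0 by rewrite lexx ltW.
have K0 : 0 <= K by exact: le_trans (normr_ge0 _) (u_bounded x0 _ T0t).
apply/ler_addgt0Pr => e e0.
have dg10 : 0 < `|dg| + 1 by rewrite ltr_wpDl.
set e2 := e / 2 / (`|dg| + 1).
have e20 : 0 < e2 by rewrite !divr_gt0.
have e2E : (`|dg| + 1) * e2 = e / 2 by rewrite mulrC divfK// gt_eqF.
have /continuous_epsP/(_ e2 e20)[rH rH0 rHP] := hamiltonian_continuous HL p.
have N0 : 0 < 1 + `|H p| by rewrite ltr_pwDl.
set e' := Num.min (Num.min 1 (rH / 2)) (e / 2 / (1 + `|H p|)).
have e'0 : 0 < e' by rewrite !lt_min ltr01 !divr_gt0.
have e'1 : e' <= 1 by rewrite !ge_min lexx.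
have e'r : e' < rH.
  apply: (@le_lt_trans _ _ (rH / 2)); first by rewrite !ge_min lexx orbT.
  by rewrite ltr_pdivrMr// mulr_natr mulr2n ltrDl.
have e'N : e' * (1 + `|H p|) <= e / 2 by rewrite -ler_pdivlMr// ge_min lexx orbT.
have [r1 r10 expand] := space_time_expansion phi x0 t0 e' cphi e'0.
have [r2 r20 gP] := is_derive_past g t0 dg e' g_derive e'0.
have r010 : 0 < Num.min r0 r1 by rewrite lt_min r00.
(* a displacement beyond min r0 r1 would cost more than the range 2 K of u *)
set Q := (2 * K + 1) / Num.min r0 r1.
have Q0 : 0 < Q by rewrite divr_gt0// ltr_wpDl// mulr_ge0.
have [M M0 LM] := lagrangian_superlinear HL Q (ltW Q0).
set r3 := 1 / ((`|dg| + 1) * (M + 1)).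
have D0 : 0 < (`|dg| + 1) * (M + 1) by rewrite mulr_gt0// ltr_wpDl.
have r30 : 0 < r3 by rewrite divr_gt0.
set k := Num.min (Num.min r0 r1) (Num.min (Num.min r2 r3) (t0 - T0)) / 2.
have m0 : 0 < Num.min (Num.min r0 r1) (Num.min (Num.min r2 r3) (t0 - T0)).
  by rewrite !lt_min r00 r10 r20 r30 subr_gt0.
have k0 : 0 < k by rewrite divr_gt0.
have : k < Num.min (Num.min r0 r1) (Num.min (Num.min r2 r3) (t0 - T0)).
  by rewrite /k ltr_pdivrMr// mulr_natr mulr2n ltrDl.
rewrite !lt_min => /andP[/andP[kr0 kr1] /andP[/andP[kr2 kr3] kT]].
have sT : T0 <= t0 - k < t0.
  by rewrite lerBrDr -lerBrDl (ltW kT) gtrBl.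
have sT' : T0 <= t0 - k <= t0 by case/andP: sT => -> /ltW.
have /andP[tau1 tau2] := gP k (ltac:(by rewrite k0)).
have tau0 := g_incr _ sT; set tau := g t0 - _ in tau0 tau1 tau2.
have dg1 := ler_norm dg.
have tauk : tau <= (`|dg| + 1) * k by apply: le_trans tau2 _; rewrite ler_pM2r//; lra.
have tauM : tau * M < 1.
  apply: (@le_lt_trans _ _ ((`|dg| + 1) * k * M)); first exact: ler_wpM2r.
  move: kr3; rewrite /r3 ltr_pdivlMr//.
  by apply: le_lt_trans; have := mulr_ge0 (ltW dg10) (ltW k0); lra.
have [q qP] := hopf_sup_attained HL tau _ x0 tau0 (u_BUC _ sT).
rewrite -u_hopf// in qP.
have tauq : `|tau *: q| < Num.min r0 r1.
  rewrite normrZ ger0_norm// -(ltr_pM2l Q0) {2}/Q divfK ?gt_eqF//.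
  have := ler_wpM2l tau0 (LM q); have := u_bounded x0 _ T0t.
  have := u_bounded (x0 + tau *: q) _ sT'; rewrite !ler_norml; lra.
move: (tauq); rewrite lt_min => /andP[tauq0 tauq1].
have yx : x0 + tau *: q - x0 = tau *: q by rewrite addrAC subrr add0r.
have h1 := max0 (x0 + tau *: q) k; rewrite yx in h1.
have {}h1 := h1 tauq0 (ltac:(by rewrite ltW)).
have h3 := expand (x0 + tau *: q) (t0 - k); rewrite yx in h3.
have tkk : t0 - k - t0 = - k by rewrite addrAC subrr add0r.
rewrite tkk normrN (ger0_norm (ltW k0)) in h3.
have {h3} := h3 tauq1 kr1.
rewrite -/p -/pt dotvZr normrZ (ger0_norm tau0) ler_norml => /andP[_ h3].
have hq : e' * `|q| <= L q - dotv p q + (H p + e2).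
  have near_p i (s : R) : `|s| <= e' -> H (p + s *: delta_mx 0 i) <= H p + e2.
    move=> se; have := rHP (p + s *: delta_mx 0 i).
    rewrite addrAC subrr add0r normrZ => hh.
    have /hh : `|s| * `|delta_mx 0 i : V| < rH.
      by apply: le_lt_trans e'r; apply: le_trans se; rewrite ler_piMr ?normr_delta_le.
    by rewrite ler_norml; lra.
  apply: (fenchel_ball HL) => //; first exact: ltW.
  - by rewrite lerDl ltW.
  - by move=> i; apply: near_p; rewrite ger0_norm// ltW.
  - by move=> i; rewrite -scaleNr; apply: near_p; rewrite normrN ger0_norm// ltW.
have h4 : k * pt <= tau * (H p + e2) + k * e'.
  have := ler_wpM2l tau0 hq; lra.
have h5 : tau * e2 <= k * (e / 2).
  rewrite [leRHS](_ : _ = (`|dg| + 1) * k * e2); last by rewrite -e2E; ring.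
  exact: (ler_wpM2r (ltW e20) tauk).
have h6 : tau * H p <= dg * k * H p + k * e' * `|H p|.
  have := increment_mul_close tau dg k e' (H p).
  by rewrite tau1 tau2 ler_norml lerBlDl => /(_ isT)/andP[].
rewrite -(ler_pM2l k0).
have := ler_wpM2l (ltW k0) e'N; lra.
Qed.

End hopf_sup_piece.
End past_viscosity.

(** * Paths made of smooth steps *)

Section step_function.
Context {R : realType}.
Implicit Types (s h : R).

Definition pos_sq (s : R) : R := Num.max 0 s ^+ 2.

(** A nondecreasing C^1 function equal to 0 before 0 and to 1 after 1: its
    derivative is a tent supported in [0, 1].  Steps glue to C^1 paths because
    this derivative vanishes at both ends. *)
Definition step (s : R) : R :=
  (pos_sq (2 * s) - 2 * pos_sq (2 * s - 1) + pos_sq (2 * s - 2)) / 2.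

Definition dstep (s : R) : R :=
  2 * (Num.max 0 (2 * s) - 2 * Num.max 0 (2 * s - 1) + Num.max 0 (2 * s - 2)).

Lemma pos_sq_expand s h : `|pos_sq (s + h) - pos_sq s - 2 * Num.max 0 s * h| <= h ^+ 2.
Proof.
rewrite /pos_sq !maxEle ler_norml.
by case: ifPn => h1; case: ifPn => h2; rewrite ?(expr0n, mulr0, mul0r) /=;
  rewrite -?ltNge in h1 h2; apply/andP; split; nra.
Qed.

Lemma step_expand s h : `|step (s + h) - step s - dstep s * h| <= 8 * h ^+ 2.
Proof.
have h1 := pos_sq_expand (2 * s) (2 * h).
have h2 := pos_sq_expand (2 * s - 1) (2 * h).
have h3 := pos_sq_expand (2 * s - 2) (2 * h).
rewrite /step /dstep mulrDr.
rewrite [2 * s + 2 * h - 1]addrAC [2 * s + 2 * h - 2]addrAC.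
move: h1 h2 h3; rewrite !ler_norml exprMn => /andP[? ?] /andP[? ?] /andP[? ?].
by apply/andP; split; lra.
Qed.

Lemma step_le0 s : s <= 0 -> step s = 0.
Proof.
by move=> s0; rewrite /step /pos_sq !max_l; try lra.
Qed.

Lemma step_ge1 s : 1 <= s -> step s = 1.
Proof. by move=> s1; rewrite /step /pos_sq !max_r; try lra; field. Qed.

Lemma dstep_le0 s : s <= 0 -> dstep s = 0.
Proof. by move=> s0; rewrite /dstep !max_l; try lra. Qed.

Lemma dstep_ge1 s : 1 <= s -> dstep s = 0.
Proof. by move=> s1; rewrite /dstep !max_r; try lra. Qed.

Lemma dstep_bounds s : 0 <= dstep s <= 2.
Proof.
rewrite /dstep !maxEle.
by case: ifPn => h1; case: ifPn => h2; case: ifPn => h3; rewrite -?ltNge in h1 h2 h3; lra.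
Qed.

Lemma dstep_continuous : continuous dstep.
Proof.
have max_lip (x y : R) : `|Num.max 0 x - Num.max 0 y| <= `|x - y|.
  have h3 := ler_norm (x - y); have h4 := ler_norm (- (x - y)).
  rewrite normrN in h4; rewrite !maxEle.
  case: ifPn => h1; case: ifPn => h2; rewrite -?ltNge in h1 h2;
    rewrite ler_norml; lra.
move=> s; apply/continuous_epsP => e e0; exists (e / 16); first exact: divr_gt0.
move=> z; rewrite ltr_pdivlMr// => zs.
have h1 := max_lip (2 * z) (2 * s).
have h2 := max_lip (2 * z - 1) (2 * s - 1).
have h3 := max_lip (2 * z - 2) (2 * s - 2).
have E (b : R) : 2 * z - b - (2 * s - b) = 2 * (z - s) by ring.
rewrite (E 1) in h2; rewrite (E 2) in h3; rewrite -mulrBr in h1.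
have n2 : `|2 * (z - s)| = 2 * `|z - s| by rewrite normrM ger0_norm.
rewrite n2 !ler_norml in h1 h2 h3.
move: h1 h2 h3 => /andP[? ?] /andP[? ?] /andP[? ?].
by rewrite /dstep ler_norml; apply/andP; split; lra.
Qed.

Lemma is_derive_step s : is_derive s 1 (step : R -> R^o) (dstep s).
Proof.
apply/is_derive_epsP => e e0; exists (e / 8); first by rewrite divr_gt0.
move=> h; rewrite ltr_pdivlMr// => he; rewrite [h *: 1]mulr1 [h * dstep s]mulrC.
apply: le_trans (step_expand s h) _; rewrite -real_normK ?num_real//.
have := normr_ge0 h; nra.
Qed.

Lemma step_increment s s' : s <= s' -> 0 <= step s' - step s <= 2 * (s' - s).
Proof.
move=> ss'; have [|z _ ->] := MVT_segment ss' (fun z _ => is_derive_step z).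
  by apply: continuous_subspaceT => z; exact: is_derive_continuous (is_derive_step z).
have := dstep_bounds z; nra.
Qed.

Lemma step_bounds s : 0 <= step s <= 1.
Proof.
have [s0|s0] := leP s 0; first by rewrite step_le0// lexx ler01.
have [s1|s1] := leP 1 s; first by rewrite step_ge1// lexx ler01.
have := step_increment 0 s (ltW s0); have := step_increment s 1 (ltW s1).
rewrite (step_le0 0)// (step_ge1 1)//; lra.
Qed.

End step_function.

Section step_path.
Context {R : realType}.
Implicit Types (j : nat -> R) (l t : R).

Definition step_at (l : R) (k : nat) (t : R) : R := step ((t - k%:R * l) / l).
Definition dstep_at (l : R) (k : nat) (t : R) : R := dstep ((t - k%:R * l) / l) / l.

(** The k-th step, of height j k, takes place in the time interval
    [k l, (k + 1) l], and the path is constant after the last one. *)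
Fixpoint step_path j l (N : nat) (t : R) : R :=
  if N is N'.+1 then step_path j l N' t + j N' * step_at l N' t else 0.

Fixpoint dstep_path j l (N : nat) (t : R) : R :=
  if N is N'.+1 then dstep_path j l N' t + j N' * dstep_at l N' t else 0.

Lemma is_derive_step_at l k t : is_derive t 1 (step_at l k : R -> R^o) (dstep_at l k t).
Proof.
rewrite /dstep_at; apply: (is_derive1_comp (f := step)); first exact: is_derive_step.
apply/is_derive_epsP => e e0; exists 1 => // h _.
rewrite [h *: 1]mulr1.
have -> : (t + h - k%:R * l) / l - (t - k%:R * l) / l - h * l^-1 = 0 by ring.
by rewrite normr0 mulr_ge0// ltW.
Qed.

Lemma is_derive_step_path j l N t :
  is_derive t 1 (step_path j l N : R -> R^o) (dstep_path j l N t).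
Proof.
elim: N => [|N IH] /=; first exact: is_derive_cst.
apply: (is_deriveD (f := (step_path j l N : R -> R^o))
  (g := (fun t => j N * step_at l N t : R^o))) => //.
apply: (is_deriveZ (f := (step_at l N : R -> R^o))).
exact: is_derive_step_at.
Qed.

Lemma dstep_path_continuous j l N : continuous (dstep_path j l N).
Proof.
elim: N => [|N IH] t /=; first exact: cvg_cst.
apply: cvgD; first exact: IH.
apply: cvgM; first exact: cvg_cst.
apply: cvgM; last exact: cvg_cst.
apply: (@continuous_comp R R R (fun t => (t - N%:R * l) / l) dstep).
  apply: cvgM; last exact: cvg_cst.
  by apply: cvgB; [exact: cvg_id|exact: cvg_cst].
exact: dstep_continuous.
Qed.

Lemma step_at_before l k t : 0 < l -> t <= k%:R * l -> step_at l k t = 0.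
Proof.
by move=> l0 tk; apply: step_le0; rewrite pmulr_lle0 ?invr_gt0// subr_le0.
Qed.

Lemma step_at_after l k t : 0 < l -> k.+1%:R * l <= t -> step_at l k t = 1.
Proof.
move=> l0 kt; apply: step_ge1; rewrite ler_pdivlMr// mul1r.
by move: kt; rewrite -natr1 mulrDl mul1r; lra.
Qed.

Lemma dstep_at_before l k t : 0 < l -> t <= k%:R * l -> dstep_at l k t = 0.
Proof.
move=> l0 tk; rewrite /dstep_at dstep_le0 ?mul0r//.
by rewrite pmulr_lle0 ?invr_gt0// subr_le0.
Qed.

Lemma dstep_at_after l k t : 0 < l -> k.+1%:R * l <= t -> dstep_at l k t = 0.
Proof.
move=> l0 kt; rewrite /dstep_at dstep_ge1 ?mul0r// ler_pdivlMr// mul1r.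
by move: kt; rewrite -natr1 mulrDl mul1r; lra.
Qed.

Lemma step_at_increment l k s t : 0 < l -> s <= t ->
  0 <= step_at l k t - step_at l k s <= 2 / l * (t - s).
Proof.
move=> l0 st.
have /step_increment : (s - k%:R * l) / l <= (t - k%:R * l) / l.
  by rewrite ler_pM2r ?invr_gt0// lerD2r.
rewrite /step_at => /andP[-> /le_trans]; apply.
by rewrite le_eqVlt; apply/orP; left; apply/eqP; ring.
Qed.

Lemma step_at_bounds l k t : 0 <= step_at l k t <= 1.
Proof. exact: step_bounds. Qed.

Lemma dstep_path_after j l N t : 0 < l -> N%:R * l <= t -> dstep_path j l N t = 0.
Proof.
move=> l0; elim: N => //= N IH Nt.
rewrite IH ?dstep_at_after ?mulr0 ?addr0//.
by apply: le_trans Nt; rewrite ler_pM2r// ler_nat.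
Qed.

Lemma step_path_after j l N t : 0 < l -> N%:R * l <= t ->
  step_path j l N t = \sum_(k < N) j k.
Proof.
move=> l0; elim: N => [|N IH] Nt /=; first by rewrite big_ord0.
rewrite IH ?step_at_after ?mulr1 ?big_ord_recr//.
by apply: le_trans Nt; rewrite ler_pM2r// ler_nat.
Qed.

Lemma step_path_before j l N k t : 0 < l -> (k <= N)%N -> t <= k%:R * l ->
  step_path j l N t = step_path j l k t.
Proof.
move=> l0; elim: N => [|N IH]; first by rewrite leqn0 => /eqP ->.
rewrite leq_eqVlt => /predU1P[-> //|]; rewrite ltnS => kN tk /=.
rewrite IH// step_at_before ?mulr0 ?addr0//.
by apply: le_trans tk _; rewrite ler_pM2r// ler_nat.
Qed.

Lemma C01_step_path j l N : 0 < l -> C01_path (step_path j l N).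
Proof.
move=> l0; split; [split|exists (dstep_path j l N); split].
- by rewrite (step_path_before _ _ _ 0)// mul0r.
- apply: continuous_subspaceT => t.
  exact: is_derive_continuous (is_derive_step_path j l N t).
- exact/continuous_subspaceT/dstep_path_continuous.
- by move=> t _; exact: is_derive_step_path.
- apply/cvgrPdist_le => e e0.
  have /is_derive_epsP/(_ e e0)[r r0 rP] := is_derive_step_path j l N 0.
  near=> h; have h0 : 0 < h by near: h; exact: nbhs_right_gt.
  have hr : h < r by near: h; exact: nbhs_right_lt.
  have := rP h; rewrite add0r [h *: 1]mulr1 gtr0_norm// => /(_ hr).
  move: (_ h) (_ 0) (dstep_path _ _ _ 0) => a b m hab.
  rewrite -(ler_pM2r h0) -[X in _ * X <= _](gtr0_norm h0) -normrM.
  by move: hab; rewrite distrC; congr (`|_| <= _); field; rewrite gt_eqF.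
Unshelve. all: end_near. Qed.

End step_path.

(** * The flow along a step path *)

Section hopf_equicontinuity.
Context {R : realType} {d : nat} {H L : 'rV[R]_d -> R} {B : 'M[R]_d} {c C : R}.
Hypothesis HL : legendre_pair H L B c C.
Local Notation V := 'rV[R]_d.
Local Notation VR := ('rV[R]_d * R)%type.

(** In time, T_a W = T_b (T_(a-b) W) and T_b is nonexpansive, so that the
    variation between b and a is at most that of the first a - b units of time. *)
Lemma hopf_sup_uniform (W : V -> R) (e : R) : BUC [set: V] W -> 0 < e ->
  exists2 r, 0 < r & forall a b x y, 0 <= a -> 0 <= b -> `|a - b| <= r ->
    `|x - y| < r -> `|hopf_sup L a W x - hopf_sup L b W y| <= e.
Proof.
move=> bW e0; have e20 : 0 < e / 2 by rewrite divr_gt0.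
have [r1 r10 r1P] := hopf_sup_small_time HL W (e / 2) bW e20.
have := bW => /BUC_setTP[_ /(_ _ e20)[r2 r20 r2P]].
have space a x y : 0 <= a -> `|x - y| < r2 -> hopf_sup L a W x <= hopf_sup L a W y + e / 2.
  move=> a0 xy; apply: (hopf_sup_leD HL) => // h.
  have := r2P (x + h) (y + h); rewrite opprD addrACA subrr addr0 => /(_ xy).
  by rewrite ltr_norml; lra.
have time a b x : 0 <= b -> b <= a -> a - b <= r1 ->
    `|hopf_sup L a W x - hopf_sup L b W x| <= e / 2.
  move=> b0 ba ab.
  have ab0 : 0 <= a - b by rewrite subr_ge0.
  have bT := BUC_hopf_sup HL (a - b) W ab0 bW.
  rewrite -(subrKC b a) -(hopf_sup_semigroup HL b (a - b) W b0 ab0 bW).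
  have small z : `|hopf_sup L (a - b) W z - W z| <= e / 2 by apply: r1P; rewrite ab0.
  have h1 : hopf_sup L b (hopf_sup L (a - b) W) x <= hopf_sup L b W x + e / 2.
    by apply: (hopf_sup_leD HL) => // h; have := small (x + h); rewrite ler_norml; lra.
  have h2 : hopf_sup L b W x <= hopf_sup L b (hopf_sup L (a - b) W) x + e / 2.
    by apply: (hopf_sup_leD HL) => // h; have := small (x + h); rewrite ler_norml; lra.
  by rewrite ler_norml; apply/andP; split; lra.
exists (Num.min r1 r2); first by rewrite lt_min r10.
move=> a b x y a0 b0; rewrite le_min lt_min => /andP[ab _] /andP[_ xy].
have yx : `|y - x| < r2 by rewrite distrC.
have ht : `|hopf_sup L a W x - hopf_sup L b W x| <= e / 2.
  have [ba|/ltW ba] := leP b a.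
    by apply: time => //; apply: le_trans ab; exact: ler_norm.
  rewrite distrC; apply: time => //; apply: le_trans ab.
  by rewrite distrC; exact: ler_norm.
have := space b x y b0 xy; have := space b y x b0 yx.
move: ht; rewrite !ler_norml => /andP[? ?] ? ?; apply/andP; split; lra.
Qed.

Lemma hopf_sup_bounded (W : V -> R) (K a A : R) : BUC [set: V] W ->
  (forall x, `|W x| <= K) -> 0 <= a <= A ->
  forall x, `|hopf_sup L a W x| <= K + A * `|L 0| + A * `|H 0|.
Proof.
move=> bW WK /andP[a0 aA] x.
have hL : - `|L 0| <= L 0 <= `|L 0| by rewrite -ler_norml.
have hH : - `|H 0| <= H 0 <= `|H 0| by rewrite -ler_norml.
have hK y : - K <= W y <= K by rewrite -ler_norml.
have aL := ler_wpM2r (normr_ge0 (L 0)) aA.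
have aH := ler_wpM2r (normr_ge0 (H 0)) aA.
have aL0 := mulr_ge0 a0 (normr_ge0 (L 0)).
have aH0 := mulr_ge0 a0 (normr_ge0 (H 0)).
rewrite ler_norml; apply/andP; split.
- apply: le_trans (hopf_sup_ub HL a W x 0 a0 bW).
  rewrite scaler0 addr0; have := hK x; move: hL => /andP[_ /(ler_wpM2l a0)]; lra.
- apply: hopf_sup_le => q; have := fenchel HL 0 q; rewrite dotv0l.
  move=> /(ler_wpM2l a0); rewrite mulr0 mulrDr.
  have := hK (x + a *: q); move: hH => /andP[_ /(ler_wpM2l a0)]; lra.
Qed.

Lemma hopf_sup_piece_viscosity (W : V -> R) (w : VR -> R) (rho : R -> R) (T0 t0 dg : R) :
  BUC [set: V] W -> T0 < t0 ->
  (forall s, T0 <= s <= t0 -> 0 <= rho s) ->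
  (forall s, T0 <= s <= t0 -> rho s <= rho t0) ->
  is_derive t0 1 (rho : R -> R^o) dg ->
  (forall x s, T0 <= s <= t0 -> w (x, s) = hopf_sup L (rho s) W x) ->
  past_subsolution_at H dg w t0 /\ past_supersolution_at H dg w t0.
Proof.
move=> bW Tt rho0 rho1 drho wE.
have tt : T0 <= t0 <= t0 by rewrite lexx ltW.
have sub s : T0 <= s < t0 -> T0 <= s <= t0 by move=> /andP[-> /ltW].
have incr s : T0 <= s < t0 -> 0 <= rho t0 - rho s.
  by move=> /sub/rho1; rewrite subr_ge0.
have wsE s : T0 <= s <= t0 -> (fun x => w (x, s)) = hopf_sup L (rho s) W.
  by move=> sT; apply/funext => x; exact: wE.
have bws s : T0 <= s < t0 -> BUC [set: V] (fun x => w (x, s)).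
  by move=> /sub sT; rewrite wsE//; apply: (BUC_hopf_sup HL) => //; exact: rho0.
have hw s x : T0 <= s < t0 -> w (x, t0) = hopf_sup L (rho t0 - rho s) (fun y => w (y, s)) x.
  move=> sT; rewrite wsE ?sub// (hopf_sup_semigroup HL) ?incr ?rho0 ?sub//.
  by rewrite subrK; exact: wE.
have [[K WK] _] := (BUC_setTP W).1 bW.
split; last exact: (hopf_sup_supersolution HL rho w T0 t0 dg).
apply: (hopf_sup_subsolution HL rho w T0 t0 dg
  (K + rho t0 * `|L 0| + rho t0 * `|H 0|)) => // x s sT.
rewrite wE//; apply: hopf_sup_bounded => //.
by rewrite rho0// rho1.
Qed.

End hopf_equicontinuity.

(** The solution operator for an increment a of the path, of either sign. *)
Definition hopf {R : realType} {d : nat} (L : 'rV[R]_d -> R) (a : R) (u : 'rV[R]_d -> R) :=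
  if 0 <= a then hopf_sup L a u else hopf_inf L (- a) u.

Fixpoint hopf_state {R : realType} {d : nat} (L : 'rV[R]_d -> R) (j : nat -> R)
    (u0 : 'rV[R]_d -> R) (N : nat) : 'rV[R]_d -> R :=
  if N is N'.+1 then hopf L (j N') (hopf_state L j u0 N') else u0.

(** The solution along [step_path]: during the N-th step the path moves by
    j N * step_at l N t away from its value at the start of the step. *)
Fixpoint hopf_flow {R : realType} {d : nat} (L : 'rV[R]_d -> R) (j : nat -> R) (l : R)
    (u0 : 'rV[R]_d -> R) (N : nat) (z : 'rV[R]_d * R) : R :=
  if N is N'.+1 then
    if z.2 <= N'%:R * l then hopf_flow L j l u0 N' z
    else hopf L (j N' * step_at l N' z.2) (hopf_state L j u0 N') z.1
  else u0 z.1.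

Section hopf_flow_theory.
Context {R : realType} {d : nat}.
Local Notation V := 'rV[R]_d.
Local Notation VR := ('rV[R]_d * R)%type.

Lemma hopf_ge0 (L : V -> R) a u : 0 <= a -> hopf L a u = hopf_sup L a u.
Proof. by rewrite /hopf => ->. Qed.

Lemma hopf_le0 (L : V -> R) a u : a <= 0 -> hopf L a u = hopf_inf L (- a) u.
Proof.
rewrite /hopf; case: ifPn => // a0 a0'.
have -> : a = 0 by apply/eqP; rewrite eq_le a0 a0'.
by rewrite oppr0 hopf_inf0 hopf_sup0.
Qed.

Context {H L : V -> R} {B : 'M[R]_d} {c C : R}.
Hypothesis HL : legendre_pair H L B c C.
Implicit Types (u W : V -> R) (j : nat -> R) (l : R).

Let HL' := legendre_pair_opp HL.

Lemma BUC_hopf a u : BUC [set: V] u -> BUC [set: V] (hopf L a u).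
Proof.
move=> bu; have [a0|a0] := leP 0 a.
  by rewrite hopf_ge0//; exact: (BUC_hopf_sup HL).
by rewrite hopf_le0 ?ltW//; apply: (BUC_hopf_inf HL) => //; rewrite oppr_ge0 ltW.
Qed.

Lemma BUC_hopf_state j u0 N : BUC [set: V] u0 -> BUC [set: V] (hopf_state L j u0 N).
Proof. by move=> b0; elim: N => //= N; exact: BUC_hopf. Qed.

Lemma hopf_flow_before j l u0 N k z : 0 < l -> (k <= N)%N -> z.2 <= k%:R * l ->
  hopf_flow L j l u0 N z = hopf_flow L j l u0 k z.
Proof.
move=> l0; elim: N => [|N IH]; first by rewrite leqn0 => /eqP ->.
rewrite leq_eqVlt => /predU1P[-> //|]; rewrite ltnS => kN zk /=.
by rewrite ifT ?IH//; apply: le_trans zk _; rewrite ler_pM2r// ler_nat.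
Qed.

Lemma hopf_flow_after j l u0 N x t : 0 < l -> N%:R * l <= t ->
  hopf_flow L j l u0 N (x, t) = hopf_state L j u0 N x.
Proof.
move=> l0; case: N => [//|N] Nt /=.
have NNt : N%:R * l < t.
  by apply: lt_le_trans Nt; rewrite ltr_pM2r// ltr_nat.
by rewrite leNgt NNt /= step_at_after// mulr1.
Qed.

Lemma hopf_flow_piece j l u0 N x t : 0 < l -> N%:R * l <= t ->
  hopf_flow L j l u0 N.+1 (x, t) = hopf L (j N * step_at l N t) (hopf_state L j u0 N) x.
Proof.
move=> l0 Nt /=; case: ifPn => // tN.
rewrite hopf_flow_after// step_at_before// mulr0 /hopf lexx.
by rewrite hopf_sup0.
Qed.

Lemma hopf_uniform W a e : BUC [set: V] W -> 0 < e ->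
  exists2 r, 0 < r & forall s t x y, 0 <= s -> 0 <= t -> `|s - t| < r ->
    `|x - y| < r -> `|hopf L (a * s) W x - hopf L (a * t) W y| <= e.
Proof.
move=> bW e0; have a1 : 0 < `|a| + 1 by rewrite ltr_wpDl.
have scale r (s t : R) : 0 < r -> `|s - t| < Num.min r (r / (`|a| + 1)) -> `|a * s - a * t| <= r.
  move=> r0; rewrite lt_min => /andP[_]; rewrite ltr_pdivlMr// => h.
  rewrite -mulrBr normrM mulrC; apply: le_trans (ltW h).
  by rewrite ler_wpM2l// lerDl.
have [a0|/ltW a0] := leP 0 a.
- have [r r0 rP] := hopf_sup_uniform HL W e bW e0.
  exists (Num.min r (r / (`|a| + 1))); first by rewrite lt_min r0 divr_gt0.
  move=> s t x y s0 t0 /(scale _ _ _ r0) st; rewrite lt_min => /andP[xy _].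
  by rewrite !hopf_ge0 ?mulr_ge0//; apply: rP; rewrite ?mulr_ge0.
- have [r r0 rP] := hopf_sup_uniform HL' _ e (BUC_opp _ _ bW) e0.
  exists (Num.min r (r / (`|a| + 1))); first by rewrite lt_min r0 divr_gt0.
  move=> s t x y s0 t0 /(scale _ _ _ r0) st; rewrite lt_min => /andP[xy _].
  rewrite !hopf_le0 ?mulr_le0_ge0// /hopf_inf -opprD normrN; apply: rP => //.
  + by rewrite oppr_ge0 mulr_le0_ge0.
  + by rewrite oppr_ge0 mulr_le0_ge0.
  + by rewrite -opprD normrN.
Qed.

Lemma hopf_bounded W a : BUC [set: V] W ->
  exists K, forall s x, 0 <= s <= 1 -> `|hopf L (a * s) W x| <= K.
Proof.
move=> bW; have [[K WK] _] := (BUC_setTP W).1 bW.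
exists (K + `|a| * `|L 0| + `|a| * `|H 0|) => s x /andP[s0 s1].
have as1 : 0 <= `|a| * s <= `|a| by rewrite mulr_ge0//= ler_piMr.
have [a0|/ltW a0] := leP 0 a.
- rewrite hopf_ge0 ?mulr_ge0//; apply: (hopf_sup_bounded HL) => //.
  by move: as1; rewrite ger0_norm.
- rewrite hopf_le0 ?mulr_le0_ge0// /hopf_inf normrN.
  have := hopf_sup_bounded HL' (fun x => - W x) K (- (a * s)) `|a|.
  rewrite /= oppr0; apply => //.
  + exact: BUC_opp.
  + by move=> y; rewrite normrN.
  + by move: as1; rewrite ler0_norm// mulNr.
Qed.

(** Uniform continuity is glued at the time N l: points on either side of it are
    compared through a point of the slice t = N l. *)
Lemma BUC_hopf_flow j l u0 N T : 0 < l -> BUC [set: V] u0 ->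
  BUC (@strip R d T) (hopf_flow L j l u0 N).
Proof.
move=> l0 b0; elim: N => [|N IH].
  have := b0 => /BUC_setTP[[K uK] uuc].
  apply/BUC_epsP; split; first by exists K => z _; exact: uK.
  move=> e /uuc[r r0 rP]; exists r => // z z' _ _.
  by rewrite prod_normE /= gt_max => /andP[zz _]; exact: rP.
set W := hopf_state L j u0 N.
have bW : BUC [set: V] W := BUC_hopf_state j u0 N b0.
have := IH => /BUC_epsP[[K1 K1P] uc1].
have [K2 K2P] := hopf_bounded W (j N) bW.
apply/BUC_epsP; split.
  exists (Num.max K1 K2) => -[x t] xt /=; case: ifP => _.
    by rewrite le_max K1P.
  by rewrite le_max K2P ?orbT// step_at_bounds.
set f := hopf_flow L j l u0 N.+1.
have fE1 x t : t <= N%:R * l -> f (x, t) = hopf_flow L j l u0 N (x, t).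
  by rewrite /f /= => ->.
have fE2 x t : N%:R * l <= t -> f (x, t) = hopf L (j N * step_at l N t) W x.
  exact: hopf_flow_piece.
move=> e e0; have e30 : 0 < e / 3 by rewrite divr_gt0.
have [r1 r10 r1P] := uc1 _ e30.
have [r2 r20 r2P] := hopf_uniform W (j N) _ bW e30.
have r2l : 0 < r2 * (l / 2) by rewrite mulr_gt0// divr_gt0.
set r := Num.min r1 (Num.min r2 (r2 * (l / 2))).
have step_close s t : s <= t -> t - s < r -> `|step_at l N t - step_at l N s| < r2.
  move=> st; rewrite !lt_min => /andP[_ /andP[_ ts]].
  have /andP[h1 h2] := step_at_increment l N s t l0 st.
  rewrite ger0_norm//; apply: le_lt_trans h2 _.
  rewrite mulrC -ltr_pdivlMr ?divr_gt0//.
  by apply: lt_le_trans ts _; rewrite invf_div.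
have late x y s t : N%:R * l <= s -> s <= t -> t - s < r -> `|x - y| < r ->
    `|f (x, t) - f (y, s)| <= e / 3.
  move=> Ns st ts xy; have Nt := le_trans Ns st.
  rewrite !fE2//; apply: r2P; rewrite ?(andP (step_at_bounds _ _ _)).1//.
  - exact: step_close.
  - by move: xy; rewrite !lt_min => /andP[_ /andP[]].
have r0 : 0 < r by rewrite !lt_min r10 r20.
suff main x y s t : 0 <= s -> s <= t -> t <= T -> t - s < r -> `|x - y| < r ->
    `|f (x, t) - f (y, s)| < e.
  exists r => // -[x t] [y s] /= /andP[t0 tT] /andP[s0 sT].
  rewrite prod_normE /= gt_max => /andP[xy ts].
  have [st|/ltW ts'] := leP s t.
    by apply: main => //; apply: le_lt_trans ts; exact: ler_norm.
  rewrite distrC; apply: main => //; last by rewrite distrC.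
  by apply: le_lt_trans ts; rewrite distrC; exact: ler_norm.
move=> s0 st tT ts xy.
have [Ns|/ltW sN] := leP (N%:R * l) s.
  apply: (@le_lt_trans _ _ (e / 3)); last lra.
  exact: late.
have early t' : 0 <= t' -> t' <= N%:R * l -> t' <= T -> s <= t' -> t' - s < r ->
    `|f (x, t') - f (y, s)| < e / 3.
  move=> t'0 t'N t'T st' t's; rewrite !fE1//; apply: r1P.
  - by rewrite /strip /= t'0.
  - by rewrite /strip /= s0 (le_trans st').
  - rewrite prod_normE /= gt_max; apply/andP; split.
      by move: xy; rewrite !lt_min => /andP[].
    by rewrite ger0_norm ?subr_ge0//; move: t's; rewrite !lt_min => /andP[].
have [tN|/ltW Nt] := leP t (N%:R * l).
  apply: (@lt_trans _ _ (e / 3)); last lra.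
  by apply: early => //; exact: le_trans st.
have N0 : 0 <= N%:R * l by rewrite mulr_ge0// ltW.
have h1 : `|f (x, t) - f (x, N%:R * l)| <= e / 3.
  by apply: late => //; [lra|rewrite subrr normr0].
have h2 : `|f (x, N%:R * l) - f (y, s)| < e / 3.
  apply: early => //; [exact: le_trans tT|lra].
rewrite -(subrK (f (x, N%:R * l)) (f (x, t))) -addrA.
by apply: le_lt_trans (ler_normD _ _) _; lra.
Qed.

Lemma past_subsolution_eq (K : V -> R) (dg : R) (u w : VR -> R) (t0 : R) :
  (forall z, z.2 <= t0 -> u z = w z) ->
  past_subsolution_at K dg w t0 -> past_subsolution_at K dg u t0.
Proof.
move=> uw ws phi cphi x0 max0; apply: ws => //; apply: filterS max0 => z h zt.
by have := h zt; rewrite !uw.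
Qed.

Lemma past_supersolution_eq (K : V -> R) (dg : R) (u w : VR -> R) (t0 : R) :
  (forall z, z.2 <= t0 -> u z = w z) ->
  past_supersolution_at K dg w t0 -> past_supersolution_at K dg u t0.
Proof.
move=> uw ws phi cphi x0 max0; apply: ws => //; apply: filterS max0 => z h zt.
by have := h zt; rewrite !uw.
Qed.

(** At a junction time the earlier piece decides, since the viscosity
    inequalities look at the past only.  A decreasing step is an increasing one
    for minus the solution and the reflected Hamiltonian. *)
Lemma hopf_flow_past_solution j l u0 N t0 : 0 < l -> BUC [set: V] u0 -> 0 < t0 ->
  past_subsolution_at H (dstep_path j l N t0) (hopf_flow L j l u0 N) t0 /\
  past_supersolution_at H (dstep_path j l N t0) (hopf_flow L j l u0 N) t0.
Proof.
move=> l0 b0; elim: N t0 => [|N IH] t0 t00.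
  apply: (hopf_sup_piece_viscosity HL u0 (fun z => u0 z.1) (fun=> 0) 0) => //.
  - by move=> x s _; rewrite hopf_sup0.
have [t0N|Nt0] := leP t0 (N%:R * l).
  have -> : dstep_path j l N.+1 t0 = dstep_path j l N t0.
    by rewrite /= dstep_at_before// mulr0 addr0.
  have uE z : z.2 <= t0 -> hopf_flow L j l u0 N.+1 z = hopf_flow L j l u0 N z.
    by move=> zt /=; rewrite ifT// (le_trans zt).
  have [h1 h2] := IH t0 t00.
  by split; [exact: past_subsolution_eq h1|exact: past_supersolution_eq h2].
have dE : dstep_path j l N.+1 t0 = j N * dstep_at l N t0.
  by rewrite /= dstep_path_after ?add0r// ltW.
have rho_derive : is_derive t0 1 (fun t => j N * step_at l N t : R^o) (j N * dstep_at l N t0).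
  apply: (is_deriveZ (f := (step_at l N : R -> R^o))).
  exact: is_derive_step_at.
have bW := BUC_hopf_state j u0 N b0.
set W := hopf_state L j u0 N in bW.
have step_incr s : N%:R * l <= s <= t0 -> step_at l N s <= step_at l N t0.
  by move=> /andP[_ st]; have := step_at_increment l N s t0 l0 st; lra.
have step0 s : 0 <= step_at l N s by have /andP[] := step_at_bounds l N s.
rewrite dE; have [a0|/ltW a0] := leP 0 (j N).
  apply: (hopf_sup_piece_viscosity HL W _ (fun t => j N * step_at l N t) (N%:R * l)) => //.
  - by move=> s _; rewrite mulr_ge0.
  - by move=> s /step_incr; exact: ler_wpM2l.
  - by move=> x s /andP[Ns _]; rewrite hopf_flow_piece// hopf_ge0// mulr_ge0.
have [h1 h2] : past_subsolution_at (H \o -%R) (- (j N * dstep_at l N t0))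
      (fun z => - hopf_flow L j l u0 N.+1 z) t0 /\
    past_supersolution_at (H \o -%R) (- (j N * dstep_at l N t0))
      (fun z => - hopf_flow L j l u0 N.+1 z) t0.
  apply: (hopf_sup_piece_viscosity HL' (fun x => - W x) _
    (fun t => - (j N * step_at l N t)) (N%:R * l)) => //.
  - exact: BUC_opp.
  - by move=> s _; rewrite oppr_ge0 mulr_le0_ge0.
  - by move=> s /step_incr h; rewrite lerN2; exact: ler_wnM2l.
  - move=> x s /andP[Ns _]; rewrite hopf_flow_piece// hopf_le0 ?mulr_le0_ge0//.
    by rewrite /hopf_inf opprK.
by split; [exact: past_subsolution_opp|exact: past_supersolution_opp].
Qed.

Lemma hopf_flow_visc_solution j l u0 N : 0 < l -> BUC [set: V] u0 ->
  visc_solution H (step_path j l N) u0 (hopf_flow L j l u0 N).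
Proof.
move=> l0 b0.
have dE t : derive1 (step_path j l N) t = dstep_path j l N t.
  by rewrite derive1E; have [_ ->] := is_derive_step_path j l N t.
split.
- by move=> T _; exact: BUC_hopf_flow.
- move=> phi cphi x0 t0 t00 max0; rewrite dE.
  have [sub _] := hopf_flow_past_solution j l u0 N t0 l0 b0 t00.
  by apply: sub => //; apply: filterS max0.
- move=> phi cphi x0 t0 t00 min0; rewrite dE.
  have [_ super] := hopf_flow_past_solution j l u0 N t0 l0 b0 t00.
  by apply: super => //; apply: filterS min0.
- by move=> x; rewrite (hopf_flow_before _ _ _ N 0) //= mul0r.
Qed.

End hopf_flow_theory.

(** * From the range of the Hopf-Lax operator to the Hessian bound *)

Fixpoint prefix_min {R : realType} (z : nat -> R) (N : nat) : R :=
  if N is N'.+1 then Num.min (prefix_min z N') (z N) else z 0%N.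

Lemma prefix_min_le {R : realType} (z : nat -> R) N i : (i <= N)%N ->
  prefix_min z N <= z i.
Proof.
elim: N => [|N IH]; first by rewrite leqn0 => /eqP ->.
rewrite leq_eqVlt => /predU1P[->|]; first by rewrite /= ge_min lexx orbT.
by rewrite ltnS => /IH h; rewrite /= ge_min h.
Qed.

(** At dual points D^2 L(q) is the inverse of D^2 H(p) = F(p)^2, so that the
    second derivative of L in the direction w F(p) is |w|^2.  A factor K > 1
    leaves room for the remainder, and the property is trivial where F(p) = 0. *)
Definition legendre_second_order {R : realType} {d : nat} (H L : 'rV[R]_d -> R)
    (F : 'rV[R]_d -> 'M[R]_d) : Prop :=
  forall p q, dotv p q = H p + L q -> forall w K, 1 < K ->
  exists2 r : R, 0 < r & forall s, `|s| < r ->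
    L (q + s *: (w *m F p)) <=
      L q + s * dotv p (w *m F p) + K / 2 * s ^+ 2 * dotv w w.

Section regularity.
Context {R : realType} {d : nat} {H L : 'rV[R]_d -> R} {B : 'M[R]_d} {c C : R}.
Hypothesis HL : legendre_pair H L B c C.
Local Notation V := 'rV[R]_d.

(** An upward step adds to the regularity by the semigroup property, and a
    downward one subtracts from it by [hopf_inf_of_sup].  A new minimum of the
    sampled path uses it up, and the range of T_0 is everything. *)
Lemma hopf_state_range (j z : nat -> R) (u0 : V -> R) N :
  (forall k, j k = z k.+1 - z k) -> BUC [set: V] u0 ->
  exists2 v, BUC [set: V] v &
    hopf_state L j u0 N = hopf_sup L (z N - prefix_min z N) v.
Proof.
move=> jz b0; elim: N => [|N [v bv IH]].
  by exists u0; rewrite //= subrr hopf_sup0.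
have bW := BUC_hopf_state HL j u0 N.+1 b0.
have mz : prefix_min z N <= z N by exact: prefix_min_le.
have [zz|zz] := leP (z N.+1) (prefix_min z N).
  by exists (hopf_state L j u0 N.+1); rewrite //= min_r// subrr hopf_sup0.
rewrite /= min_l ?(ltW zz)// IH jz.
have a0 : 0 <= z N - prefix_min z N by rewrite subr_ge0.
have [h0|h0] := leP 0 (z N.+1 - z N).
  exists v => //; rewrite hopf_ge0// (hopf_sup_semigroup HL)//.
  by rewrite addrA subrK.
exists (hopf_inf L (z N - prefix_min z N) (hopf_sup L (z N - prefix_min z N) v)).
  by apply: (BUC_hopf_inf HL) => //; exact: (BUC_hopf_sup HL).
rewrite hopf_le0 ?ltW// (hopf_inf_of_sup HL) ?oppr_ge0 ?(ltW h0)//.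
  by congr hopf_sup; ring.
lra.
Qed.

Lemma hopf_state_fixed (j z : nat -> R) (u0 : V -> R) N i a :
  (forall k, j k = z k.+1 - z k) -> BUC [set: V] u0 ->
  (i <= N)%N -> 0 <= a <= z N - z i ->
  hopf_sup L a (hopf_inf L a (hopf_state L j u0 N)) = hopf_state L j u0 N.
Proof.
move=> jz b0 iN /andP[a0 az].
have [v bv ->] := hopf_state_range j z u0 N jz b0.
have := prefix_min_le z N i iN; set b := z N - _ => mz.
have ab : 0 <= b - a by rewrite /b; lra.
rewrite -(subrKC a b) -(hopf_sup_semigroup HL a (b - a))//.
by apply: (hopf_sup_inf_sup HL) => //; exact: (BUC_hopf_sup HL).
Qed.

(** T_a and S_a are nonexpansive for the sup norm. *)
Lemma hopf_fixed_closed (u : V -> R) a : 0 <= a -> BUC [set: V] u ->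
  (forall e, 0 < e -> exists w, [/\ BUC [set: V] w,
     hopf_sup L a (hopf_inf L a w) = w & forall x, `|u x - w x| < e]) ->
  hopf_sup L a (hopf_inf L a u) = u.
Proof.
move=> a0 bu approx; have bSu := BUC_hopf_inf HL a u a0 bu.
apply/funext => x; apply/eqP; rewrite eq_le (hopf_sup_inf_le HL)//=.
apply/ler_addgt0Pr => e e0.
have [w [bw wE uw]] := approx (e / 2) (divr_gt0 e0 (ltr0Sn _ _)).
have h1 : hopf_sup L a (hopf_inf L a w) x <= hopf_sup L a (hopf_inf L a u) x + e / 2.
  apply: (hopf_sup_leD HL) => // h; apply: (hopf_inf_leD HL) => // h'.
  by have := uw (x + h + h'); rewrite ltr_norml; lra.
rewrite wE in h1; have := uw x; rewrite ltr_norml; lra.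
Qed.

(** A test function phi touching u from above at x0 also lies above
    the translate of - a L(- . / a) that touches u from below there.  Comparing
    first derivatives identifies D phi (x0) with the momentum dual to q, and
    comparing second derivatives along w F(p) gives the bound. *)
Lemma touching_visc_hess_le (F : V -> 'M[R]_d) (u : V -> R) (a : R) : 0 < a ->
  (forall p, (F p)^T = F p) -> legendre_second_order H L F ->
  (forall x, exists q, forall e, u x + a * L q - a * L (q - a^-1 *: e) <= u (x + e)) ->
  visc_hess_le F u a^-1.
Proof.
move=> a0 Fsym L2 touch phi sphi x0 max0.
have c2 : Ck 2 phi := sphi 2%N; have c1 := Ck2_Ck1 phi c2.
have [q qP] := touch x0.
have [p pq] := legendre_momentum HL q.
have phiP e : a * L q - a * L (q - a^-1 *: e) <= phi (x0 + e) - phi x0.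
  by have := qP e; have := max0 (x0 + e); lra.
have line (v : V) (s : R) : is_derive s 1 (fun s : R => phi (x0 + s *: v) : R^o)
    ('D_v (phi : V -> R^o) (x0 + s *: v)) by exact: Ck1_line.
have gradE : grad phi x0 = p.
  apply/rowP => i; rewrite -[LHS]dotv_deltal -[RHS]dotv_deltal; set v := delta_mx 0 i.
  rewrite -derive_grad//.
  have := line v 0; rewrite scale0r addr0.
  move=> /first_order_touching; apply => s.
  instantiate (1 := C * dotv (v *m B) v / a).
  have := phiP (s *: v); rewrite scale0r addr0; apply: le_trans.
  have := legendre_upper HL p q (- (a^-1 *: (s *: v))) pq.
  rewrite scalerA mulNmx dotvNl !dotvNr opprK -scalemxAl dotvZl !dotvZr.
  move=> /(ler_wpM2l (ltW a0)).
  have -> : a * (L q - a^-1 * s * dotv p v + C * (a^-1 * s * (a^-1 * s * dotv (v *m B) v))) =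
    a * L q - s * dotv p v + C * dotv (v *m B) v / a * s ^+ 2.
    by field; rewrite gt_eqF.
  rewrite [dotv v p]dotvC; lra.
rewrite gradE => w; set v := w *m F p.
have hE : qform (- (F p *m hess phi x0 *m F p)) w =
    - 'D_v ('D_v (phi : V -> R^o) : V -> R^o) x0.
  rewrite derive2_hess// /qform /v trmx_mul Fsym !mulmxA mulmxN mulNmx mxE.
  by rewrite !mulmxA.
rewrite hE qform_scalar lerNl.
have dvv0 := dotv_ge0 w.
suff main K : 1 < K -> - (K * (a^-1 * dotv w w)) <= 'D_v ('D_v (phi : V -> R^o) : V -> R^o) x0.
  have Y0 : 0 <= a^-1 * dotv w w by rewrite mulr_ge0// invr_ge0 ltW.
  apply/ler_addgt0Pr => e e0.
  have Y1 : 0 < a^-1 * dotv w w + 1 by rewrite ltr_wpDl.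
  have := main (1 + e / (a^-1 * dotv w w + 1)).
  rewrite ltrDl divr_gt0// => /(_ isT).
  rewrite mulrDl mul1r -[e / _ * _]mulrA.
  have : e * ((a^-1 * dotv w w + 1)^-1 * (a^-1 * dotv w w)) <= e.
    by rewrite ler_piMr ?ltW// mulrC ltr_pdivrMr// mul1r ltrDl.
  lra.
move=> K1; have [r r0 rP] := L2 p q pq w K K1.
have ra0 : 0 < r * a by exact: mulr_gt0.
apply: (second_order_touching (fun s : R => phi (x0 + s *: v))
  (fun s => 'D_v (phi : V -> R^o) (x0 + s *: v)) _ _ (r * a) ra0 (line v)).
  have := Ck1_line ('D_v (phi : V -> R^o)) x0 v 0 (Ck2_derive phi v c2).
  by rewrite scale0r addr0.
move=> s sr; rewrite scale0r addr0.
have := phiP (s *: v); apply: le_trans.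
have := rP (- (a^-1 * s)); rewrite normrN normrM gtr0_norm ?invr_gt0//.
rewrite mulrC ltr_pdivrMr// => /(_ sr).
rewrite -/v scaleNr -scalerA sqrrN mulNr => /(ler_wpM2l (ltW a0)).
have -> : a * (L q - a^-1 * s * dotv p v + K / 2 * (a^-1 * s) ^+ 2 * dotv w w) =
    a * L q - s * dotv p v + K * (a^-1 * dotv w w) / 2 * s ^+ 2.
  by field; rewrite gt_eqF.
by rewrite derive_grad// gradE [dotv v p]dotvC; lra.
Qed.

(** The bound holds with 1 / a for every a < b, and a tends to b. *)
Lemma fixed_visc_hess_le (F : V -> 'M[R]_d) (u : V -> R) (b : R) : 0 < b ->
  (forall p, (F p)^T = F p) -> legendre_second_order H L F -> BUC [set: V] u ->
  (forall a, 0 < a < b -> hopf_sup L a (hopf_inf L a u) = u) ->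
  visc_hess_le F u b^-1.
Proof.
move=> b0 Fsym L2 bu fixed phi sphi x0 max0 w.
have qE a : qform a^-1%:M w = dotv w w / a.
  by rewrite qform_scalar mulrC.
have Y0 := dotv_ge0 w.
set X := qform _ w; rewrite qE ler_pdivlMr//.
have small a : 0 < a < b -> X * a <= dotv w w.
  move=> ab; have a0 : 0 < a by case/andP: ab.
  have bSu := BUC_hopf_inf HL a u (ltW a0) bu.
  have touch x : exists q, forall e, u x + a * L q - a * L (q - a^-1 *: e) <= u (x + e).
    by have := hopf_sup_touching HL a (hopf_inf L a u) x a0 bSu; rewrite fixed.
  have := touching_visc_hess_le F u a a0 Fsym L2 touch phi sphi x0 max0 w.
  by rewrite qE ler_pdivlMr.
(* otherwise dotv w w / X < b, and the midpoint of the two contradicts small *)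
rewrite leNgt; apply/negP => h.
have X0 : 0 < X by rewrite -(pmulr_lgt0 _ b0); exact: le_lt_trans h.
have YX : dotv w w / X < b by rewrite ltr_pdivrMr// mulrC.
have YX0 : 0 <= dotv w w / X by rewrite divr_ge0// ltW.
have := small ((dotv w w / X + b) / 2) (ltac:(apply/andP; split; lra)).
have -> : X * ((dotv w w / X + b) / 2) = (dotv w w + X * b) / 2.
  by field; rewrite gt_eqF.
lra.
Qed.

End regularity.

(** * Legendre pairs: quadratic Hamiltonians *)

(** When no square root exists the chosen value is the default 0, for which the
    second-order bounds on the dual are trivial. *)
Lemma Froot_cases {R : realType} {d : nat} (H : 'rV[R]_d -> R) (p : 'rV[R]_d) :
  Froot H p = 0 \/ is_spd_sqrt (hess H p) (Froot H p).
Proof.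
rewrite /Froot /sqrtmx; case: xgetP => [M _ MP|_]; first by right.
by left.
Qed.

Lemma Froot_sym {R : realType} {d : nat} (H : 'rV[R]_d -> R) (p : 'rV[R]_d) :
  (Froot H p)^T = Froot H p.
Proof.
by case: (Froot_cases H p) => [->|[]//]; rewrite trmx0.
Qed.

Section quadratic_pair.
Context {R : realType} {d : nat} (A : 'M[R]_d) (theta : R) (H : 'rV[R]_d -> R).
Hypotheses (Asym : A^T = A) (theta0 : 0 < theta) (Ale : lemx theta%:M A)
  (HA : forall p, H p = qform A p) (H2 : Ck 2 H).
Local Notation V := 'rV[R]_d.

Let Ai := invmx A.

Lemma quadratic_form_eq0 (p : V) : qform A p <= 0 -> p = 0.
Proof.
move=> p0; apply: dotv_eq0; apply/eqP; rewrite eq_le dotv_ge0 andbT.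
by rewrite -(pmulr_rle0 _ theta0) -qform_scalar (le_trans (Ale p)).
Qed.

Lemma quadratic_unitmx : A \in unitmx.
Proof.
rewrite -row_free_unit -kermx_eq0; apply/eqP/row_matrixP => i; rewrite row0.
apply: quadratic_form_eq0; rewrite qform_dotv.
have -> : row i (kermx A) *m A = 0 by rewrite -row_mul mulmx_ker row0.
by rewrite dotv0l.
Qed.

Lemma quadratic_inv_sym : Ai^T = Ai.
Proof. by rewrite /Ai trmx_inv Asym. Qed.

Definition quadratic_dual (q : V) : R := dotv (q *m Ai) q / 4.

(** Completion of the square. *)
Lemma quadratic_fenchel_gap p q :
  H p + quadratic_dual q - dotv p q = qform A (p - 2^-1 *: (q *m Ai)).
Proof.
rewrite HA !qform_dotv /quadratic_dual mulmxBl -scalemxAl mulmxKV ?quadratic_unitmx//.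
rewrite !(dotvDl, dotvDr, dotvNl, dotvNr, dotvZl, dotvZr).
rewrite [dotv (p *m A) (q *m Ai)]dotv_mulmx Asym mulmxKV ?quadratic_unitmx//.
by rewrite (dotvC q p) [dotv q (q *m Ai)]dotvC; field.
Qed.

Lemma quadratic_legendre_pair : legendre_pair H quadratic_dual Ai 2^-1 2^-1.
Proof.
have A_ge0 p : 0 <= qform A p.
  apply: le_trans (Ale p); rewrite qform_scalar mulr_ge0 ?dotv_ge0//; exact: ltW.
split.
- by move=> p q; have := A_ge0 (p - 2^-1 *: (q *m Ai)); rewrite -quadratic_fenchel_gap; lra.
- move=> p; exists (2 *: (p *m A)).
  have := quadratic_fenchel_gap p (2 *: (p *m A)).
  rewrite -scalemxAl mulmxK ?quadratic_unitmx// scalerA mulVf// scale1r subrr.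
  by rewrite qform_dotv dotv0r; lra.
- move=> q; exists (2^-1 *: (q *m Ai)).
  have := quadratic_fenchel_gap (2^-1 *: (q *m Ai)) q.
  by rewrite subrr qform_dotv dotv0r; lra.
- by case: H2.
- move=> r; have := A_ge0 (r *m Ai); rewrite qform_dotv mulmxKV ?quadratic_unitmx//.
  by rewrite dotvC.
- by rewrite invr_gt0.
- move=> q k r _; rewrite /mixed_diff /quadratic_dual !mulmxDl.
  rewrite !(dotvDl, dotvDr).
  have sym x y : dotv (x *m Ai) y = dotv (y *m Ai) x.
    by rewrite dotv_mulmx quadratic_inv_sym dotvC.
  rewrite (sym k q) (sym r q) (sym r k).
  by apply/andP; split; lra.
Qed.

Lemma quadratic_hess p : hess H p = 2 *: A.
Proof.
have dH x v : is_derive x v (H : V -> R^o) (2 * dotv (x *m A) v).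
  apply/is_derive_epsP => e e0.
  have N0 : 0 < `|qform A v| + 1 by rewrite ltr_wpDl.
  exists (e / (`|qform A v| + 1)); first by rewrite divr_gt0.
  move=> h; rewrite ltr_pdivlMr// => he.
  have -> : H (x + h *: v) - H x - h * (2 * dotv (x *m A) v) = h * (h * qform A v).
    rewrite !HA !qform_dotv mulmxDl -scalemxAl.
    rewrite !(dotvDl, dotvDr, dotvZl, dotvZr).
    by rewrite [dotv (v *m A) x]dotv_mulmx Asym [dotv v _]dotvC; ring.
  rewrite normrM mulrC ler_wpM2r// normrM.
  by have := normr_ge0 h; lra.
apply/matrixP => i j; rewrite !mxE.
have -> : 'D_(basis_vec R j) (H : V -> R^o) = fun x => 2 * dotv (x *m A) (basis_vec R j).
  by apply/funext => x; have [_ ->] := dH x (basis_vec R j).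
have : is_derive p (basis_vec R i)
   ((fun x => 2 * dotv (x *m A) (basis_vec R j)) : V -> R^o) (2 * A i j).
  apply/is_derive_epsP => e e0; exists 1 => // h _.
  rewrite mulmxDl dotvDl -scalemxAl dotvZl -rowE [dotv (row i A) _]dotvC.
  rewrite dotv_deltal mxE (_ : _ - _ - _ = 0) ?normr0 ?mulr_ge0 ?(ltW e0)//.
  by ring.
by move=> [_ ->].
Qed.

Lemma quadratic_second_order : legendre_second_order H quadratic_dual (Froot H).
Proof.
move=> p q pq w K K1; exists 1 => // s _.
have [->|[_ _ FF]] := Froot_cases H p.
  rewrite mulmx0 scaler0 addr0 dotv0r mulr0 addr0 lerDl.
  by rewrite mulr_ge0 ?dotv_ge0// mulr_ge0 ?sqr_ge0// divr_ge0//; lra.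
set F := Froot H p in FF *; rewrite quadratic_hess in FF.
have pE : p = 2^-1 *: (q *m Ai).
  apply/eqP; rewrite -subr_eq0; apply/eqP/quadratic_form_eq0.
  by rewrite -quadratic_fenchel_gap pq; lra.
have FFAi : F *m (2^-1 *: (F *m Ai)) = 1%:M.
  by rewrite -scalemxAr mulmxA FF -scalemxAl mulmxV ?quadratic_unitmx// scalerA mulVf// scale1r.
have [Fu _] := mulmx1_unit FFAi.
have FAF : F *m Ai *m F = 2%:M.
  have : F *m (F *m Ai *m F) = 2 *: F.
    by rewrite !mulmxA FF -!scalemxAl mulmxV ?quadratic_unitmx// mul1mx.
  move=> /(congr1 (mulmx (invmx F))); rewrite mulKmx//.
  by rewrite -scalemxAr mulVmx// scalemx1.
have symF : F^T = F := Froot_sym H p.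
have wFF : dotv (w *m F *m Ai) (w *m F) = 2 * dotv w w.
  rewrite dotvC dotv_mulmx symF -!mulmxA [F *m (Ai *m F)]mulmxA FAF.
  by rewrite mul_mx_scalar dotvZr.
rewrite /quadratic_dual mulmxDl -scalemxAl.
rewrite !(dotvDl, dotvDr, dotvZl, dotvZr) wFF.
rewrite [dotv (w *m F *m Ai) q]dotv_mulmx quadratic_inv_sym [dotv (w *m F) _]dotvC.
rewrite pE dotvZl; have := dotv_ge0 w.
have : 0 <= (K - 1) / 2 * s ^+ 2 * dotv w w.
  by rewrite mulr_ge0 ?dotv_ge0// mulr_ge0 ?sqr_ge0// divr_ge0//; lra.
rewrite expr2; lra.
Qed.

End quadratic_pair.

(** * Legendre pairs: one space dimension *)

Section one_dimensional_dual.
Context {R : realType} (h g g' : R -> R) (theta Theta : R).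
Hypotheses (theta0 : 0 < theta) (Theta0 : 0 < Theta).
Hypothesis dh : forall s : R, is_derive s 1 (h : R -> R^o) (g s).
Hypothesis dg : forall s : R, is_derive s 1 (g : R -> R^o) (g' s).
Hypothesis g'_bounds : forall s, theta <= g' s <= Theta.

Lemma momentum_increment s t : s <= t ->
  theta * (t - s) <= g t - g s <= Theta * (t - s).
Proof.
move=> st; have [z _ ->] := mean_value_continuous g g' s t st dg.
have /andP[h1 h2] := g'_bounds z; have ts : 0 <= t - s by rewrite subr_ge0.
by rewrite !ler_wpM2r.
Qed.

Lemma momentum_surjective y : exists s, g s = y.
Proof.
(* g grows at least at rate theta, so it reaches y within distance r of 0 *)
set r := `|y - g 0| / theta.
have r0 : 0 <= r by rewrite divr_ge0// ltW.
have rE : theta * r = `|y - g 0| by rewrite mulrC divfK// gt_eqF.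
have /andP[h1 _] := momentum_increment 0 r r0.
have /andP[h2 _] := momentum_increment (- r) 0 (ltac:(by rewrite oppr_le0)).
rewrite subr0 rE in h1; rewrite sub0r opprK rE in h2.
have h3 := ler_norm (y - g 0); have h4 := ler_norm (- (y - g 0)); rewrite normrN in h4.
have cg : {within `[(- r), r], continuous g}.
  by apply: continuous_subspaceT => s; exact: is_derive_continuous (dg s).
have rr : - r <= r by rewrite (@le_trans _ _ 0)// oppr_le0.
have yr : Num.min (g (- r)) (g r) <= y <= Num.max (g (- r)) (g r).
  by rewrite ge_min le_max; apply/andP; split; apply/orP; [left|right]; lra.
by have [s _ gs] := IVT rr cg yr; exists s.
Qed.

Lemma hamiltonian_above_tangent s t : h s + g s * (t - s) <= h t.
Proof.
have [st|/ltW ts] := leP s t.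
  have [z /andP[sz _] zE] := mean_value_continuous h g s t st dh.
  have /andP[+ _] := momentum_increment s z sz.
  have : 0 <= theta * (z - s) by rewrite mulr_ge0 ?subr_ge0// ltW.
  move=> h1 h2; have : 0 <= (g z - g s) * (t - s).
    by rewrite mulr_ge0 ?subr_ge0//; lra.
  lra.
have [z /andP[_ zs] zE] := mean_value_continuous h g t s ts dh.
have /andP[+ _] := momentum_increment z s zs.
have : 0 <= theta * (s - z) by rewrite mulr_ge0 ?subr_ge0// ltW.
move=> h1 h2; have : 0 <= (g s - g z) * (s - t).
  by rewrite mulr_ge0 ?subr_ge0//; lra.
lra.
Qed.

Definition momentum_inv (y : R) : R := xget 0 [set s | g s = y].
Local Notation G := momentum_inv.

Lemma momentum_invK y : g (G y) = y.
Proof.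
rewrite /momentum_inv; case: xgetP => // none.
by have [s gs] := momentum_surjective y; case: (none s).
Qed.

Lemma momentum_inv_bounds y z : y <= z ->
  (z - y) / Theta <= G z - G y <= (z - y) / theta.
Proof.
move=> yz; rewrite ler_pdivrMr// ler_pdivlMr//.
have [yz'|/ltW zy'] := leP (G y) (G z).
  have := momentum_increment _ _ yz'; rewrite !momentum_invK; lra.
have := momentum_increment _ _ zy'; rewrite !momentum_invK => /andP[h1 h2].
have h3 : 0 <= theta * (G y - G z) by rewrite mulr_ge0 ?subr_ge0// ltW.
have zyE : z = y by lra.
by rewrite zyE !subrr !mul0r lexx.
Qed.

Definition dual1 (y : R) : R := G y * y - h (G y).

Lemma dual1_fenchel s y : s * y <= h s + dual1 y.
Proof.
have := hamiltonian_above_tangent (G y) s; rewrite momentum_invK /dual1; lra.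
Qed.

Lemma dual1_velocity s : s * g s = h s + dual1 (g s).
Proof.
have [E|E|E] := ltgtP (G (g s)) s.
- have := momentum_increment _ _ (ltW E); rewrite momentum_invK subrr => /andP[h1 _].
  have : 0 < theta * (s - G (g s)) by rewrite mulr_gt0// subr_gt0.
  lra.
- have := momentum_increment _ _ (ltW E); rewrite momentum_invK subrr => /andP[h1 _].
  have : 0 < theta * (G (g s) - s) by rewrite mulr_gt0// subr_gt0.
  lra.
- by rewrite /dual1 E; ring.
Qed.

Lemma dual1_momentum y : G y * y = h (G y) + dual1 y.
Proof. by rewrite /dual1; ring. Qed.

(** The Fenchel inequalities between y and y + k trap the increment of the dual
    between k G(y) and k G(y + k), and G is Lipschitz. *)
Lemma is_derive_dual1 (y : R) : is_derive y 1 (dual1 : R -> R^o) (G y).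
Proof.
apply/is_derive_epsP => e e0; exists (e * theta); first exact: mulr_gt0.
move=> k kr; rewrite [k *: 1]mulr1.
have h1 := dual1_fenchel (G y) (y + k); rewrite mulrDr dual1_momentum in h1.
have h2 := dual1_fenchel (G (y + k)) y.
have h3 := dual1_momentum (y + k); rewrite mulrDr in h3.
have lo : 0 <= dual1 (y + k) - dual1 y - k * G y by lra.
have hi : dual1 (y + k) - dual1 y - k * G y <= (G (y + k) - G y) * k by lra.
rewrite ger0_norm//; apply: le_trans hi _.
have ke : `|k| / theta <= e by rewrite ler_pdivrMr// ltW.
have [k0|k0] := leP 0 k.
  have /andP[_ h4] := momentum_inv_bounds y (y + k) (ltac:(by rewrite lerDl)).
  rewrite ger0_norm// in ke *; apply: ler_wpM2r => //.
  by apply: le_trans h4 _; move: ke; rewrite addrAC subrr add0r.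
have /andP[_ h4] := momentum_inv_bounds (y + k) y (ltac:(by rewrite gerDl ltW)).
rewrite ltr0_norm// in ke *; rewrite -mulrNN; apply: ler_wpM2r.
  by rewrite oppr_ge0 ltW.
rewrite opprB; apply: le_trans h4 _.
by rewrite opprD addrA subrr add0r.
Qed.

(** The map s -> L (y + k + s) - L (y + s) has derivative
    G (y + k + s) - G (y + s), which lies between k / Theta and k / theta. *)
Lemma dual1_mixed y k r : 0 <= k -> 0 <= r ->
  Theta^-1 * (k * r) <= dual1 (y + k + r) - dual1 (y + k) - dual1 (y + r) + dual1 y
    <= theta^-1 * (k * r).
Proof.
move=> k0 r0; pose f s := dual1 (y + k + s) - dual1 (y + s).
have shift (z s : R) : is_derive s 1 (fun s => dual1 (z + s) : R^o) (G (z + s)).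
  have /is_derive_epsP dd := is_derive_dual1 (z + s); apply/is_derive_epsP => e /dd[q q0 qP].
  by exists q => // t /qP; rewrite addrA.
have df (s : R) : is_derive s 1 (f : R -> R^o) (G (y + k + s) - G (y + s)).
  by apply: (is_deriveB (f := (fun s => dual1 (y + k + s) : R^o))).
have [z _ zE] := mean_value_continuous f (fun s => G (y + k + s) - G (y + s)) 0 r r0 df.
rewrite subr0 /f !addr0 in zE.
have -> : dual1 (y + k + r) - dual1 (y + k) - dual1 (y + r) + dual1 y =
  dual1 (y + k + r) - dual1 (y + r) - (dual1 (y + k) - dual1 y) by ring.
rewrite zE.
have := momentum_inv_bounds (y + z) (y + k + z) (ltac:(by rewrite lerD2r lerDl)).
have -> : y + k + z - (y + z) = k by ring.
move=> /andP[h1 h2]; rewrite !mulrA ![_^-1 * k]mulrC.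
by apply/andP; split; apply: ler_wpM2r.
Qed.

Lemma dual1_subgradient_unique s y : s * y = h s + dual1 y -> s = G y.
Proof.
move=> sy; apply/esym.
have d0 : is_derive (0 : R) 1 (fun k => dual1 (y + k) : R^o) (G y).
  have /is_derive_epsP dd := is_derive_dual1 y; apply/is_derive_epsP => e /dd[q q0 qP].
  by exists q => // t /qP; rewrite add0r addr0.
apply: (first_order_touching _ _ s 0 d0) => k.
rewrite addr0 mul0r subr0; have := dual1_fenchel s (y + k); lra.
Qed.

(** The slope of G = L' at y is 1 / g'(G y) < kappa, so near y the
    graph of G lies below the line of slope kappa through (y, G y) to the right
    of y, and above it to the left; integrate. *)
Lemma dual1_second_order y kappa : 1 < kappa * g' (G y) ->
  exists2 r : R, 0 < r & forall s, `|s| < r ->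
    dual1 (y + s) <= dual1 y + s * G y + kappa / 2 * s ^+ 2.
Proof.
move=> k1; have /andP[D1 _] := g'_bounds (G y).
set p := G y in k1 D1 *; set D := g' p in k1 D1.
have D0 : 0 < D by exact: lt_le_trans D1.
have k0 : 0 < kappa by rewrite -(pmulr_lgt0 _ D0); exact: lt_trans k1.
set e := (kappa * D - 1) / kappa.
have e0 : 0 < e by rewrite divr_gt0// subr_gt0.
have eE : e * kappa = kappa * D - 1 by rewrite divfK// gt_eqF.
have /is_derive_epsP/(_ e e0)[r r0 rP] := dg p.
exists (r / kappa); first exact: divr_gt0.
have near s : `|s| < r / kappa ->
    (0 <= s -> G (y + s) - p - kappa * s <= 0) /\ (s <= 0 -> 0 <= G (y + s) - p - kappa * s).
  rewrite ltr_pdivlMr// => sr.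
  have ksr : `|kappa * s| < r by rewrite normrM gtr0_norm// mulrC.
  have := rP _ ksr; rewrite [(kappa * s) *: 1]mulr1 momentum_invK -/D.
  rewrite normrM (gtr0_norm k0) mulrA eE ler_norml => /andP[h1 h2].
  split=> s0.
    rewrite ger0_norm// in h1 h2.
    have gs : y + s <= g (p + kappa * s) by lra.
    have [/ltW E|E] := ltP (p + kappa * s) (G (y + s)); last lra.
    have := momentum_increment _ _ E; rewrite momentum_invK => /andP[h3 _].
    have h4 : theta * (G (y + s) - (p + kappa * s)) <= 0 by lra.
    by rewrite pmulr_rle0// in h4; lra.
  rewrite ler0_norm// in h1 h2.
  have gs : g (p + kappa * s) <= y + s by lra.
  have [/ltW E|E] := ltP (G (y + s)) (p + kappa * s); last lra.
  have := momentum_increment _ _ E; rewrite momentum_invK => /andP[h3 _].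
  have h4 : theta * (p + kappa * s - G (y + s)) <= 0 by lra.
  by rewrite pmulr_rle0// in h4; lra.
pose f s := dual1 (y + s) - s * p - kappa / 2 * s ^+ 2.
have df (s : R) : is_derive s 1 (f : R -> R^o) (G (y + s) - p - kappa * s).
  have /is_derive_epsP dd := is_derive_dual1 (y + s); apply/is_derive_epsP => e' e'0.
  have e'20 : 0 < e' / 2 by rewrite divr_gt0.
  have [q q0 qP] := dd _ e'20.
  exists (Num.min q (e' / kappa)); first by rewrite lt_min q0 divr_gt0.
  move=> t; rewrite lt_min ltr_pdivlMr// => /andP[/qP h1 h2].
  rewrite [t *: 1]mulr1 in h1 *.
  have -> : f (s + t) - f s - t * (G (y + s) - p - kappa * s) =
      (dual1 (y + s + t) - dual1 (y + s) - t * G (y + s)) - kappa / 2 * t * t.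
    by rewrite /f addrA; field.
  apply: le_trans (ler_normB _ _) _; rewrite !normrM (gtr0_norm k0).
  rewrite [`|2^-1|]ger0_norm ?invr_ge0//.
  have := ler_wpM2r (normr_ge0 t) (ltW h2); lra.
move=> s sr.
suff : f s <= f 0 by rewrite /f addr0 mul0r expr0n /= mulr0; lra.
have [s0|/ltW s0] := leP 0 s.
  have [z /andP[z0 zs] zE] := mean_value_continuous _ _ 0 s s0 df.
  have zr : `|z| < r / kappa.
    by apply: le_lt_trans sr; rewrite !ger0_norm.
  have [/(_ z0) h1 _] := near z zr.
  by rewrite -subr_le0 zE; apply: mulr_le0_ge0 => //; rewrite subr0.
have [z /andP[zs z0] zE] := mean_value_continuous _ _ s 0 s0 df.
have zr : `|z| < r / kappa.
  by apply: le_lt_trans sr; rewrite !ler0_norm// lerN2.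
have [_ /(_ z0) h1] := near z zr.
by rewrite -subr_ge0 zE; apply: mulr_ge0 => //; rewrite sub0r oppr_ge0.
Qed.

End one_dimensional_dual.

Section one_dimensional_pair.
Context {R : realType} (H : 'rV[R]_1 -> R) (theta Theta : R).
Hypotheses (H2 : Ck 2 H) (theta0 : 0 < theta) (Theta0 : 0 < Theta).
Hypothesis Hbounds : forall p, lemx theta%:M (hess H p) /\ lemx (hess H p) Theta%:M.
Local Notation V := 'rV[R]_1.
Let e0 : V := delta_mx 0 0.
Let h (s : R) : R := H (0 + s *: e0).
Let g (s : R) : R := 'D_e0 (H : V -> R^o) (0 + s *: e0).
Let g' (s : R) : R := 'D_e0 ('D_e0 (H : V -> R^o) : V -> R^o) (0 + s *: e0).

Lemma row1E (q : V) : q = 0 + q 0 0 *: e0.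
Proof. by apply/rowP => i; rewrite !mxE (ord1 i) eqxx mulr1 add0r. Qed.

Lemma dotv1E (p q : V) : dotv p q = p 0 0 * q 0 0.
Proof. by rewrite dotvE big_ord1. Qed.

Let dh (s : R) : is_derive s 1 (h : R -> R^o) (g s).
Proof. exact/Ck1_line/Ck2_Ck1. Qed.

Let dg (s : R) : is_derive s 1 (g : R -> R^o) (g' s).
Proof. exact/Ck1_line/Ck2_derive. Qed.

Let g'_bounds s : theta <= g' s <= Theta.
Proof.
rewrite /g' derive2_hess//; have [h1 h2] := Hbounds (0 + s *: e0).
have := h1 e0; have := h2 e0; rewrite !qform_scalar dotv_deltal mxE /= !mulr1.
by move=> -> ->.
Qed.

Definition dual_row1 (q : V) : R := dual1 h g (q 0 0).

Let HE p : H p = h (p 0 0).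
Proof. by rewrite /h -row1E. Qed.

Lemma row1_legendre_pair : legendre_pair H dual_row1 1%:M Theta^-1 theta^-1.
Proof.
split.
- move=> p q; rewrite dotv1E HE.
  exact: (dual1_fenchel h g g' theta Theta).
- move=> p; exists (0 + g (p 0 0) *: e0).
  rewrite dotv1E HE /dual_row1 !mxE eqxx mulr1 add0r.
  exact: (dual1_velocity h g g' theta Theta).
- move=> q; exists (0 + momentum_inv g (q 0 0) *: e0).
  rewrite dotv1E HE /dual_row1 !mxE eqxx mulr1 add0r.
  exact: dual1_momentum.
- by case: H2.
- by move=> r; rewrite mulmx1 dotv_ge0.
- by rewrite invr_gt0.
- move=> q k r; rewrite mulmx1 dotv1E /mixed_diff /dual_row1 !mxE.
  set y := q 0 0; set a := k 0 0; set b := r 0 0 => ab.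
  have [a0|a0] := leP 0 a; have [b0|b0] := leP 0 b.
  + exact: (dual1_mixed h g g' theta Theta).
  + have aE : a = 0 by move: ab; nra.
    by rewrite aE !addr0 !mul0r !mulr0 (_ : _ - _ - _ + _ = 0) ?lexx//; ring.
  + have bE : b = 0 by move: ab; nra.
    by rewrite bE !addr0 !mulr0 (_ : _ - _ - _ + _ = 0) ?lexx//; ring.
  (* the mixed difference is symmetric under exchange of opposite corners *)
  + have := dual1_mixed h g g' theta Theta theta0 Theta0 dh dg g'_bounds (y + a + b) (- a) (- b).
    rewrite !oppr_ge0 => /(_ (ltW a0) (ltW b0)); rewrite mulrNN.
    have -> : y + a + b - a - b = y by ring.
    have -> : y + a + b - a = y + b by ring.
    have -> : y + a + b - b = y + a by ring.
    by move=> /andP[h1 h2]; apply/andP; split; lra.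
Qed.

Lemma row1_second_order : legendre_second_order H dual_row1 (Froot H).
Proof.
move=> p q pq w K K1.
have [->|[_ _ FF]] := Froot_cases H p.
  exists 1 => // s _; rewrite mulmx0 scaler0 addr0 dotv0r mulr0 addr0 lerDl.
  by rewrite mulr_ge0 ?dotv_ge0// mulr_ge0 ?sqr_ge0// divr_ge0//; lra.
set F := Froot H p in FF *; set f := F 0 0.
rewrite dotv1E HE /dual_row1 in pq.
have pE := dual1_subgradient_unique h g g' theta Theta theta0 Theta0 dh dg g'_bounds _ _ pq.
have ff : f * f = g' (p 0 0).
  have := congr1 (fun M : 'M[R]_1 => M 0 0) FF; rewrite mxE big_ord1 -/f => ->.
  by rewrite /g' -row1E mxE.
have /andP[D1 _] := g'_bounds (p 0 0).
have D0 : 0 < g' (p 0 0) by exact: lt_le_trans D1.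
set kappa := K / g' (p 0 0).
have kE : kappa * g' (p 0 0) = K by rewrite divfK// gt_eqF.
have [r r0 rP] := dual1_second_order h g g' theta Theta theta0 Theta0 dh dg g'_bounds (q 0 0) kappa
  (ltac:(by rewrite -pE kE)).
have N0 : 0 < `|w 0 0 * f| + 1 by rewrite ltr_wpDl.
exists (r / (`|w 0 0 * f| + 1)); first exact: divr_gt0.
move=> s; rewrite ltr_pdivlMr// => sr.
have wF : (w *m F) 0 0 = w 0 0 * f by rewrite mxE big_ord1.
have := rP (s * (w 0 0 * f)); rewrite normrM => rP'.
have sw : `|s| * `|w 0 0 * f| < r.
  by apply: le_lt_trans sr; apply: ler_wpM2l => //; rewrite lerDl.
have {}rP' := rP' sw.
rewrite /dual_row1 dotv1E dotv1E !mxE -/f big_ord1 -/f.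
apply: le_trans rP' _; rewrite -pE.
have -> : kappa / 2 * (s * (w 0 0 * f)) ^+ 2 = kappa * (f * f) / 2 * s ^+ 2 * (w 0 0 * w 0 0).
  by ring.
rewrite ff kE; lra.
Qed.

End one_dimensional_pair.

(** * Pathwise solutions *)

Section path_approximation.
Context {R : realType} (zeta : R -> R).
Hypothesis zeta_cont : {within `[0, +oo[, continuous zeta}.

(** Heine's theorem, by compactness of [0, T].  The second point may lie slightly
    beyond T, where the next grid point after a time of [0, T] can be. *)
Lemma path_uniform_continuity (T e : R) : 0 < e -> exists2 r, 0 < r &
  forall s s' : R, 0 <= s <= T -> 0 <= s' -> `|s - s'| < r -> `|zeta s - zeta s'| < e.
Proof.
move=> e0; have e20 : 0 < e / 2 by rewrite divr_gt0.
have cov := (@compact_near_coveringP R `[0, T]).1 (@segment_compact R 0 T).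
pose P (r s : R) := 0 <= s ->
  forall s', 0 <= s' -> `|s - s'| < r -> `|zeta s - zeta s'| < e.
have : \forall r \near 0^'+, `[0, T]%classic `<=` P r.
  apply: cov => x; rewrite /= in_itv /= => /andP[x0 _].
  have Ax : [set` `[0, +oo[] x by rewrite /= in_itv /= andbT.
  have /cvgrPdist_lt/(_ _ e20) :=
    (subspace_continuousP _ _).1 zeta_cont x Ax.
  move=> /nbhs_ballP[r0 /= r00 r0P].
  have close y : 0 <= y -> `|x - y| < r0 -> `|zeta x - zeta y| < e / 2.
    by move=> y0 xy; apply: (r0P y); rewrite -?ball_normE //= in_itv /= andbT.
  have r020 : 0 < r0 / 2 by rewrite divr_gt0.
  exists (ball x (r0 / 2), [set r | r < r0 / 2]) => /=.
    by split; [exact: nbhsx_ballx|exact: nbhs_right_lt].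
  move=> [s r] /= [xs rr] s0 s' s'0 ss'.
  rewrite -ball_normE /= in xs.
  have xs' : `|x - s| < r0 by lra.
  have h1 := close s s0 xs'.
  have h2 : `|zeta x - zeta s'| < e / 2.
    apply: close => //; rewrite -(subrKA s).
    by apply: le_lt_trans (ler_normD _ _) _; lra.
  rewrite -(subrKA (zeta x)); apply: le_lt_trans (ler_normD _ _) _.
  by rewrite distrC; lra.
move=> /nbhs_ballP[r0 /= r00 Hr].
have r020 : 0 < r0 / 2 by rewrite divr_gt0.
exists (r0 / 2) => // s s' /andP[s0 sT] s'0 ss'.
have rb : ball (0 : R) r0 (r0 / 2).
  by rewrite -ball_normE /= sub0r normrN gtr0_norm//; lra.
by apply: (Hr _ rb r020 s) => //=; rewrite in_itv /= s0.
Qed.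

Hypothesis zeta0 : zeta 0 = 0.

Definition sample (l : R) (k : nat) : R := zeta (k%:R * l).
Definition jump (l : R) (k : nat) : R := sample l k.+1 - sample l k.

Lemma sum_jump l k : \sum_(i < k) jump l i = sample l k.
Proof.
rewrite -(big_mkord xpredT (jump l)) telescope_sumr//.
by rewrite {2}/sample mul0r zeta0 subr0.
Qed.

(** The path and its interpolation both stay close to the value of zeta at
    the last grid point, as increments over one mesh are small. *)
Lemma sampled_path_close (l r e T s : R) (N : nat) : 0 < l -> l < r ->
  (forall s s' : R, 0 <= s <= T -> 0 <= s' -> `|s - s'| < r -> `|zeta s - zeta s'| < e / 3) ->
  0 <= s <= T -> s < N%:R * l -> `|zeta s - step_path (jump l) l N s| < e.
Proof.
move=> l0 lr uc sT sN; have s0 : 0 <= s by case/andP: sT.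
have sl0 : 0 <= s / l by rewrite divr_ge0// ltW.
set k := Num.truncn (s / l).
have /andP[] := truncn_itv sl0; rewrite -/k ler_pdivlMr// ltr_pdivrMr// => ks sk.
have kN : (k < N)%N.
  by rewrite -(ltr_nat R) -(ltr_pM2r l0); exact: le_lt_trans sN.
rewrite (step_path_before _ _ _ k.+1)// ?ltW//= step_path_after// sum_jump.
have kl0 : 0 <= k%:R * l by rewrite mulr_ge0// ltW.
have k1l : k.+1%:R * l = k%:R * l + l by rewrite -natr1 mulrDl mul1r.
have h1 : `|zeta s - sample l k| < e / 3.
  by apply: uc => //; rewrite ger0_norm; lra.
have h2 : `|zeta s - sample l k.+1| < e / 3.
  by apply: uc => //; rewrite ?k1l ?ler0_norm; lra.
have /andP[t0 t1] := step_at_bounds l k s.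
have h3 : `|jump l k * step_at l k s| <= `|jump l k|.
  by rewrite normrM (ger0_norm t0) ler_piMr.
have h4 : `|jump l k| < e / 3 + e / 3.
  rewrite /jump -(subrKA (zeta s)); apply: le_lt_trans (ler_normD _ _) _.
  by rewrite distrC; lra.
rewrite opprD addrA; apply: le_lt_trans (ler_normB _ _) _; lra.
Qed.

End path_approximation.

Section pathwise.
Context {R : realType} {d : nat} {H L : 'rV[R]_d -> R} {B : 'M[R]_d} {c C : R}.
Hypothesis HL : legendre_pair H L B c C.
Local Notation V := 'rV[R]_d.

Let mesh (t : R) (n : nat) : R := t / n.+1%:R.

Lemma mesh_gt0 t n : 0 < t -> 0 < mesh t n.
Proof. by move=> t0; rewrite divr_gt0. Qed.

Lemma mesh_last t n : n.+1%:R * mesh t n = t.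
Proof. by rewrite mulrC divfK. Qed.

Lemma mesh_small t r : 0 < t -> 0 < r -> exists n0, forall n, (n0 <= n)%N -> mesh t n < r.
Proof.
move=> t0 r0; exists (Num.truncn (t / r)) => n n0n.
rewrite ltr_pdivrMr// mulrC -ltr_pdivrMr//.
apply: lt_le_trans (real_truncnS_gt (num_real _)) _.
by rewrite ler_nat ltnS.
Qed.

(** The mesh is t / (n + 1), so that t is a grid point, reached after n + 1
    complete steps.  There are (n + 1)^2 steps, so that the interpolation follows
    zeta up to the time (n + 1) t and converges locally uniformly. *)
Lemma pathwise_hopf_state (zeta : R -> R) u0 u t : C0_path zeta ->
  BUC [set: V] u0 -> pathwise_solution H zeta u0 u -> 0 < t ->
  forall e, 0 < e -> exists n0, forall n, (n0 <= n)%N -> forall x,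
    `|u (x, t) - hopf_state L (jump zeta (mesh t n)) u0 n.+1 x| < e.
Proof.
move=> [z0 zc] b0 usol t0 e e0.
pose l := mesh t; pose j n := jump zeta (l n).
pose zeta_ n := step_path (j n) (l n) (n.+1 * n.+1).
pose u_ n := hopf_flow L (j n) (l n) u0 (n.+1 * n.+1).
have lgt0 n : 0 < l n by exact: mesh_gt0.
have conv T : 0 < T -> {uniform `[0, T], zeta_ @ \oo --> zeta}.
  move=> T0; apply/uniform_epsP => e1 e10.
  have [r r0 rP] := path_uniform_continuity zeta zc T _ (divr_gt0 e10 (ltr0Sn _ 2)).
  have [n1 n1P] := mesh_small t r t0 r0.
  exists (maxn n1 (Num.truncn (T / t))) => n; rewrite geq_max => /andP[nn1 nT] s.
  rewrite /= in_itv /= => sT.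
  apply: (sampled_path_close _ z0 (l n) r e1 T) => //; first exact: n1P.
  rewrite natrM -mulrA mesh_last; apply: le_lt_trans (_ : s <= T) _.
    by case/andP: sT.
  rewrite -ltr_pdivrMr//; apply: lt_le_trans (real_truncnS_gt (num_real _)) _.
  by rewrite ler_nat ltnS.
have u0c : {uniform [set: V], (fun=> u0) @ \oo --> u0}.
  by apply/uniform_epsP => e1 e10; exists 0%N => n _ x _; rewrite subrr normr0.
have sol n : visc_solution H (zeta_ n) u0 (u_ n).
  exact: (hopf_flow_visc_solution HL).
have := usol zeta_ (fun=> u0) u_ (fun n => C01_step_path _ _ _ (lgt0 n)) conv
  (fun=> b0) u0c sol t t0.
move=> /uniform_epsP/(_ e e0)[n0 n0P]; exists n0 => n /n0P nP x.
have := nP (x, t); rewrite /strip /= lexx ltW// => /(_ isT).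
rewrite /u_ (hopf_flow_before _ _ _ _ n.+1)//; last 2 first.
- by rewrite leq_pmulr.
- by rewrite /l mesh_last.
by rewrite hopf_flow_after// /l mesh_last.
Qed.

Lemma sample_near (zeta : R -> R) t s e : C0_path zeta -> 0 < t -> 0 <= s <= t -> 0 < e ->
  exists n0, forall n, (n0 <= n)%N -> exists2 i, (i <= n.+1)%N &
    `|zeta s - sample zeta (mesh t n) i| < e.
Proof.
move=> [z0 zc] t0 st e0.
have [r r0 rP] := path_uniform_continuity zeta zc t e e0.
have [n0 n0P] := mesh_small t r t0 r0.
exists n0 => n nn0; set l := mesh t n.
have l0 : 0 < l by exact: mesh_gt0.
have /andP[s0 s1] := st.
have sl0 : 0 <= s / l by rewrite divr_ge0// ltW.
have /andP[] := truncn_itv sl0; set k := Num.truncn _.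
rewrite ler_pdivlMr// ltr_pdivrMr// => ks sk.
exists k.
  by rewrite -(ler_nat R) -(ler_pM2r l0) mesh_last; exact: le_trans s1.
apply: rP => //; first by rewrite mulr_ge0// ltW.
rewrite ger0_norm ?subr_ge0//; apply: lt_trans (n0P n nn0).
by move: sk; rewrite -natr1 mulrDl mul1r; rewrite -/l; lra.
Qed.

Lemma hopf_state_opp (j : nat -> R) u0 N :
  hopf_state (L \o -%R) (fun k => - j k) (fun x => - u0 x) N =
  fun x => - hopf_state L j u0 N x.
Proof.
elim: N => //= N ->; set W := hopf_state L j u0 N; apply/funext => x.
have LE : (L \o -%R) \o -%R = L by apply/funext => y /=; rewrite opprK.
have WE : (fun y => - - W y) = W by apply/funext => y; rewrite opprK.
have [a0|/ltW a0] := leP 0 (j N).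
  by rewrite hopf_le0 ?oppr_le0// (hopf_ge0 L)// opprK /hopf_inf LE WE.
by rewrite hopf_ge0 ?oppr_ge0// (hopf_le0 L)// /hopf_inf opprK.
Qed.

(** For a fine mesh some grid point i is so close to s that the sampled path
    rises by at least a from i to the time t. *)
Lemma pathwise_hopf_fixed (zeta : R -> R) u0 u t a s : C0_path zeta ->
  BUC [set: V] u0 -> BUC [set: V] (fun x => u (x, t)) ->
  pathwise_solution H zeta u0 u -> 0 < t -> 0 <= s <= t ->
  0 < a < zeta t - zeta s ->
  hopf_sup L a (hopf_inf L a (fun x => u (x, t))) = fun x => u (x, t).
Proof.
move=> zC b0 but usol t0 st /andP[a0 aa].
apply: (hopf_fixed_closed HL) => //; first exact: ltW.
move=> e e0; have [n1 n1P] := pathwise_hopf_state zeta u0 u t zC b0 usol t0 e e0.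
have ea0 : 0 < zeta t - zeta s - a by lra.
have [n2 n2P] := sample_near zeta t s _ zC t0 st ea0.
pose n := maxn n1 n2.
have [i iN zi] := n2P n (leq_maxr _ _).
exists (hopf_state L (jump zeta (mesh t n)) u0 n.+1); split.
- exact: (BUC_hopf_state HL).
- apply: (hopf_state_fixed HL (jump zeta (mesh t n)) (sample zeta (mesh t n)) u0 n.+1 i) => //.
  rewrite (ltW a0) /= {1}/sample mesh_last; move: zi; rewrite ltr_norml; lra.
- by move=> x; apply: n1P; rewrite leq_maxl.
Qed.

Lemma pathwise_hopf_fixed_opp (zeta : R -> R) u0 u t a s : C0_path zeta ->
  BUC [set: V] u0 -> BUC [set: V] (fun x => u (x, t)) ->
  pathwise_solution H zeta u0 u -> 0 < t -> 0 <= s <= t ->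
  0 < a < zeta s - zeta t ->
  hopf_sup (L \o -%R) a (hopf_inf (L \o -%R) a (fun x => - u (x, t))) =
    fun x => - u (x, t).
Proof.
move=> zC b0 but usol t0 st /andP[a0 aa].
have HL' := legendre_pair_opp HL.
apply: (hopf_fixed_closed HL'); [exact: ltW|exact: BUC_opp|].
move=> e e0; have [n1 n1P] := pathwise_hopf_state zeta u0 u t zC b0 usol t0 e e0.
have ea0 : 0 < zeta s - zeta t - a by lra.
have [n2 n2P] := sample_near zeta t s _ zC t0 st ea0.
pose n := maxn n1 n2.
have [i iN zi] := n2P n (leq_maxr _ _).
pose W := hopf_state L (jump zeta (mesh t n)) u0 n.+1.
have bW : BUC [set: V] W := BUC_hopf_state HL _ _ _ b0.
exists (fun x => - W x); split.
- exact: BUC_opp.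
- rewrite -hopf_state_opp.
  apply: (hopf_state_fixed HL' _ (fun k => - sample zeta (mesh t n) k) _ n.+1 i) => //.
  + by move=> k; rewrite /jump; ring.
  + exact: BUC_opp.
  rewrite (ltW a0) /= {1}/sample mesh_last; move: zi; rewrite ltr_norml; lra.
- by move=> x; rewrite -opprD normrN; apply: n1P; rewrite leq_maxl.
Qed.

End pathwise.

Section reflection.
Context {R : realType} {d : nat}.
Local Notation V := 'rV[R]_d.

Lemma smooth_opp (phi : V -> R) : smooth phi -> smooth (fun x => - phi x).
Proof. by move=> sphi k; exact: Ck_opp. Qed.

Lemma grad_opp (phi : V -> R) x : Ck 1 phi -> grad (fun x => - phi x) x = - grad phi x.
Proof.
move=> cphi; apply/rowP => i; rewrite !mxE.
by have [_ ->] := is_deriveN (f := (phi : V -> R^o)) (Ck1_is_derive phi x (basis_vec R i) cphi).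
Qed.

Lemma hess_opp (phi : V -> R) x : Ck 2 phi -> hess (fun x => - phi x) x = - hess phi x.
Proof.
move=> c2; have c1 := Ck2_Ck1 phi c2; apply/matrixP => i j; rewrite !mxE.
have -> : 'D_(basis_vec R j) ((fun x => - phi x) : V -> R^o) =
    fun x => - 'D_(basis_vec R j) (phi : V -> R^o) x.
  apply/funext => y.
  by have [_ ->] := is_deriveN (f := (phi : V -> R^o)) (Ck1_is_derive phi y (basis_vec R j) c1).
have dd := Ck1_is_derive _ x (basis_vec R i) (Ck2_derive phi (basis_vec R j) c2).
by have [_ ->] := is_deriveN (f := ('D_(basis_vec R j) (phi : V -> R^o) : V -> R^o)) dd.
Qed.

(** Test functions from below for v are minus test functions from above for
    - v, with opposite gradients. *)
Lemma visc_hess_ge_opp (F : V -> 'M[R]_d) (v : V -> R) (K : R) :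
  visc_hess_le (F \o -%R) (fun x => - v x) K -> visc_hess_ge F v (- K).
Proof.
move=> le phi sphi x0 min0 w.
have := le _ (smooth_opp phi sphi) x0 _ w.
rewrite grad_opp ?hess_opp /= ?opprK; [|exact: (sphi 2%N)|exact: (sphi 1%N)].
rewrite mulmxN mulNmx opprK => /(_ (fun x => ltac:(have := min0 x; lra))).
rewrite !qform_scalar !qform_dotv !mulmxN !dotvNl; lra.
Qed.

Lemma legendre_second_order_opp (H L : V -> R) F : legendre_second_order H L F ->
  legendre_second_order (H \o -%R) (L \o -%R) (F \o -%R).
Proof.
move=> L2 p q /= pq w K K1.
have pq' : dotv (- p) (- q) = H (- p) + L (- q) by rewrite dotvNl dotvNr opprK.
have [r r0 rP] := L2 _ _ pq' (- w) K K1.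
exists r => // s /rP.
by rewrite !mulNmx scalerN -opprD !dotvNl !dotvNr !opprK.
Qed.

End reflection.

Lemma exists_legendre_pair {R : realType} {d : nat} (H : 'rV[R]_d -> R) :
  uniformly_convex H -> d = 1%N \/ ((1 < d)%N /\ quadratic H) ->
  exists (L : 'rV[R]_d -> R) (B : 'M[R]_d) (c C : R),
    legendre_pair H L B c C /\ legendre_second_order H L (Froot H).
Proof.
move=> [H2 [m [M [m0 M0 Hb]]]] [d1|[_ [A [Asym [th [Th [th0 _ Ale _]]] HA]]]].
- subst d; exists (dual_row1 H), 1%:M, M^-1, m^-1; split.
  + exact: row1_legendre_pair.
  + exact: (row1_second_order H m M).
- exists (quadratic_dual A), (invmx A), 2^-1, 2^-1; split.
  + exact: (quadratic_legendre_pair A th).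
  + exact: (quadratic_second_order A th).
Qed.

Theorem theorem1p5 (R : realType) (d : nat) (H : 'rV[R]_d -> R)
  (H_convex : uniformly_convex H)
  (H_dim : d = 1%N \/ ((1 < d)%N /\ quadratic H))
  (zeta : R -> R) (zeta_C0 : C0_path zeta)
  (u0 : 'rV[R]_d -> R) (u0_BUC : BUC [set: 'rV[R]_d] u0)
  (u : 'rV[R]_d * R -> R)
  (u_BUC : BUC (@halfspace R d) u)
  (u_sol : pathwise_solution H zeta u0 u)
  (t : R) (t_gt0 : 0 < t) :
  (run_max zeta t - zeta t != 0 ->
     visc_hess_ge (Froot H) (fun x => u (x, t))
       (- (run_max zeta t - zeta t)^-1)) /\
  (zeta t - run_min zeta t != 0 ->
     visc_hess_le (Froot H) (fun x => u (x, t))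
       (zeta t - run_min zeta t)^-1).
Proof.
have [L [B [c [C [HL L2]]]]] := exists_legendre_pair H H_convex H_dim.
have but : BUC [set: 'rV[R]_d] (fun x => u (x, t)).
  have := u_BUC => /BUC_epsP[[K uK] uuc]; apply/BUC_setTP; split.
    by exists K => x; apply: uK; rewrite /halfspace /= ltW.
  move=> e /uuc[r r0 rP]; exists r => // x y xy.
  apply: rP; rewrite /halfspace /= ?ltW//.
  by rewrite prod_normE /= subrr normr0 gt_max xy.
have t0t : 0 <= t by exact: ltW.
have zc : {within `[0, t], continuous zeta}.
  case: zeta_C0 => _; apply: continuous_subspaceW => s /=.
  by rewrite !in_itv /= andbT => /andP[].
have img0 : (zeta @` `[0, t]) !=set0.
  by exists (zeta t), t; rewrite //= in_itv /= t0t lexx.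
have ztin : (zeta @` `[0, t]) (zeta t) by exists t; rewrite //= in_itv /= t0t lexx.
split=> nz.
- have [s1 _ s1P] := EVT_max t0t zc.
  have pos : 0 < run_max zeta t - zeta t.
    rewrite lt_neqAle eq_sym nz subr_ge0; apply: ub_le_sup => //.
    by exists (zeta s1) => _ [s sin <-]; exact: s1P.
  apply: visc_hess_ge_opp.
  apply: (fixed_visc_hess_le (legendre_pair_opp HL) (Froot H \o -%R)
    (fun x => - u (x, t)) _ pos).
  + by move=> p; exact: Froot_sym.
  + exact: legendre_second_order_opp.
  + exact: BUC_opp.
  + move=> a /andP[a0 ab].
    have /(sup_gt img0)[_ [s sin <-] zs] : zeta t + a < run_max zeta t by lra.
    move: sin; rewrite /= in_itv /= => sin.
    apply: (pathwise_hopf_fixed_opp HL zeta u0 u t a s) => //.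
    by rewrite a0; lra.
- have [s1 _ s1P] := EVT_min t0t zc.
  have pos : 0 < zeta t - run_min zeta t.
    rewrite lt_neqAle eq_sym nz subr_ge0; apply: ge_inf => //.
    by exists (zeta s1) => _ [s sin <-]; exact: s1P.
  apply: (fixed_visc_hess_le HL (Froot H) (fun x => u (x, t)) _ pos) => //.
  + by move=> p; exact: Froot_sym.
  + move=> a /andP[a0 ab].
    have /(inf_lt img0)[_ [s sin <-] zs] : run_min zeta t < zeta t - a by lra.
    move: sin; rewrite /= in_itv /= => sin.
    apply: (pathwise_hopf_fixed HL zeta u0 u t a s) => //.
    by rewrite a0; lra.
Qed.
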